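(* Let $\Omega=\{(x,y)\in\mathbb{R}^2:x^2+y^2\le1\}$ and let $u\in\hat C$ be a minimizer of $J_\infty$ over $\hat C$. If $\omega$ is a nonempty open subset of $\Omega$ and $u\in C^2(\omega)$, then $u$ is not strictly convex on $\omega$.
   Context: $\hat C$ denotes the set of all functions $u\colon\Omega\to[-1,0]$ that are convex and closed (i.e. lower semicontinuous). Each such $u$ is locally Lipschitz in $\operatorname{int}\Omega$, hence differentiable a.e. For $u\in\hat C$, \[ J_\infty(u)=\int_\Omega \frac{1}{|\nabla u(x)|^2}\,dx \in [0,\infty], \] where the integrand is taken to be $+\infty$ where $\nabla u=0$. Here ''open'' means open in $\mathbb{R}^2$. *)

(* Defs.v *)
From HB Require Import structures.
From mathcomp Require Import all_boot all_order all_algebra.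
From mathcomp Require Import all_classical all_reals all_analysis.

Set Implicit Arguments.
Unset Strict Implicit.
Unset Printing Implicit Defensive.

Import Order.TTheory GRing.Theory Num.Theory.
Import numFieldNormedType.Exports.

Local Open Scope classical_set_scope.
Local Open Scope ring_scope.
Local Open Scope convex_scope.

Definition Omega (R : realType) : set (R * R) :=
  [set p | p.1 ^+ 2 + p.2 ^+ 2 <= 1].

(* A function on Omega is represented by a total function on the plane; its
   values outside Omega are irrelevant. In particular lower semicontinuity is
   taken for the topology of Omega, not of the plane. *)
Definition Chat (R : realType) : set (R * R -> R) :=
  [set u | [/\ forall p, Omega p -> -1 <= u p <= 0,
               convex_function (@Omega R) u &
               lower_semicontinuous
                 ((fun p => (u p)%:E) : subspace (@Omega R) -> \bar R)]].

Definition stdvec (R : realType) (i : 'I_2) : R * R :=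
  if i == ord0 then (1, 0) else (0, 1).

Definition grad (R : realType) (u : R * R -> R) (p : R * R) : R * R :=
  ('D_(stdvec R ord0) u p, 'D_(stdvec R ord_max) u p).

(* Euclidean; the library norm on R * R is the sup norm. *)
Definition sqnorm (R : realType) (v : R * R) : R := v.1 ^+ 2 + v.2 ^+ 2.

(* The total operator 'D_v takes arbitrary values where u is not derivable and
   depends on the values of u outside Omega on the boundary circle. For u in
   Chat these points form a null set, so Jinfty u depends only on u on Omega. *)
Definition Jinfty (R : realType) (u : R * R -> R) : \bar R :=
  (\int[@lebesgue_measure R \x @lebesgue_measure R]_(p in @Omega R)
     (if grad u p == 0%R then +oo else ((sqnorm (grad u p))^-1)%:E))%E.

Definition minimizer (T : Type) (R : realType) (C : set T) (J : T -> \bar R)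
    (u : T) : Prop :=
  C u /\ forall v, C v -> (J u <= J v)%E.

(* D is meant to be open: partial derivatives up to order n exist and are
   continuous on D. *)
Fixpoint Cn_on (R : realType) (n : nat) (D : set (R * R)) (f : R * R -> R) :
    Prop :=
  (forall p, D p -> {for p, continuous f}) /\
  if n is m.+1 then
    forall i : 'I_2,
      (forall p, D p -> derivable f p (stdvec R i)) /\
      Cn_on m D ('D_(stdvec R i) f)
  else True.

(* D need not be convex: the strict inequality is only required on segments
   contained in D. *)
Definition strictly_convex_on (R : realType) (E : lmodType R)
    (E' := convex_lmodType E) (D : set E') (f : E' -> R^o) : Prop :=
  forall x y : E', x != y -> (forall s : {i01 R}, D (x <| s |> y)) ->
    forall t : {i01 R}, 0 < t%:num < 1 ->
      f (x <| t |> y) < f x <| t |> f y.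

(* Main.v *)
Require Import Defs.
From HB Require Import structures.
From mathcomp Require Import all_boot all_order all_algebra.
From mathcomp Require Import all_classical all_reals all_analysis.
From mathcomp Require Import measurable_realfun ring lra.
Import Order.TTheory GRing.Theory Num.Theory.
Import numFieldNormedType.Exports.

Local Open Scope classical_set_scope.
Local Open Scope ring_scope.

(** The integrand F(p) = |p|^-2 is convex in the direction of p and concave in
the directions nearly orthogonal to p. Hence, where u leaves room for it, an
oscillation of u orthogonally to its gradient lowers the functional.

Room is what strict convexity gives. Fix x0 in omega and let l be the tangent
plane of u at x0. Strict convexity makes u - l positive on a circle around x0, so
for a small K > 0 the function u - l - K |x - x0|^2 has an interior minimum z
near x0 ([exists_touching]), and at z the Hessian of u is at least K
([hess_ge_of_touching]). By continuity u is uniformly convex on a square around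
z, and z can be moved so that grad u z is not 0
([exists_strongly_convex_square]); then also -1 < u z < 0
([strictly_between]). Convexity on the disk propagates the uniform convexity: the
convexity defect of u on a segment of the disk is at least c t (1 - t) |x - y|^2
as soon as one of the points x, y, t x + (1 - t) y is near z
([exists_conv_gap_ge]). The convexity defect of a function phi with Lipschitz
gradient is at most C t (1 - t) |x - y|^2 ([C11_conv_gap]), so u + tau phi stays in
the admissible class for phi supported near z and tau small of either sign
([perturb_Chat]).

The perturbations are phi_1 = eta sin (a . x) and phi_2 = eta cos (a . x), with eta
a bump and a = N e, where e is orthogonal to grad u z. The four competitors
u + t phi_1, u - t phi_1, u + t phi_2, u - t phi_2 are averaged: the signs cancel
the first order terms, which replaces the Euler-Lagrange equation, and
sin^2 + cos^2 = 1 cancels the products of eta with its gradient. Up to terms that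
are small with t, the sum of the four integrands minus 4 F(grad u) is
2 t^2 (N^2 eta^2 Q(e) + Q(grad eta)) / |grad u|^6 with
Q(h) = 4 (grad u . h)^2 - |h|^2 |grad u|^2, and Q(e) < 0
([four_directions_le]). So it is at most t^2 L on the support of eta and at most
t^2 (L - c N^2) on a smaller square, with L and c independent of N. Integration and
N large contradict minimality ([amplitude_contra]); the minimum is finite because
an affine function has finite resistance ([Jinfty_tilt_lty]).

The gradients are known to be meaningful only near z. Elsewhere the integrand may
fail to be measurable, and its integral is the supremum of the integrals of the
simple functions below it. The integrated comparison is proved for such lower
integrals ([measure_le_of_minimal]). *)

(** * Second differences of the inverse square *)

Section InverseSquare.
Context (R : realType).
Implicit Types (P s H t : R).

(** With P = |p|^2, s = p . h and H = |h|^2 the two terms are |p + t h|^-2 and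
|p - t h|^-2. Their sum is 2 (P + t^2 H) / D with D = (P + t^2 H)^2 - 4 t^2 s^2;
the coefficient of t^2 in its expansion is 2 (4 s^2 - H P) / P^3, and the bounds on
t make the rest of order t^4 at most t^2 / 2. *)
Lemma inv_second_difference_le P s H t :
  0 < P -> 0 <= H -> s ^+ 2 <= P * H -> 8 * (t ^+ 2 * H) <= P ->
  50 * (t ^+ 2 * H ^+ 2) <= P ^+ 3 ->
  [/\ 0 < P + 2 * (t * s) + t ^+ 2 * H, 0 < P - 2 * (t * s) + t ^+ 2 * H &
  (P + 2 * (t * s) + t ^+ 2 * H)^-1 + (P - 2 * (t * s) + t ^+ 2 * H)^-1
    <= 2 / P + t ^+ 2 * (2 * (4 * s ^+ 2 - H * P) / P ^+ 3 + 2^-1)].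
Proof.
move=> P0 H0 sPH tH1 tH2.
set tau := t ^+ 2 in tH1 tH2 *.
have tau0 : 0 <= tau by exact: sqr_ge0.
set a := 2 * (t * s).
have a2 : a ^+ 2 = 4 * (tau * s ^+ 2) by rewrite /a /tau; ring.
have tH0 : 0 <= tau * H by exact: mulr_ge0.
have tsPH : tau * s ^+ 2 <= P * (tau * H).
  by rewrite (mulrCA P); exact: ler_wpM2l.
have aP : a ^+ 2 <= P ^+ 2 / 2 by rewrite a2; nra.
have [aP1 aP2] : a < P /\ - P < a.
  have P20 : 0 < P ^+ 2 by rewrite exprn_gt0.
  split; rewrite ltNge; apply/negP => h; nra.
set D := (P + tau * H) ^+ 2 - a ^+ 2.
have D0 : P ^+ 2 / 2 <= D by rewrite /D; nra.
have x0 : 0 < P + a + tau * H by lra.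
have y0 : 0 < P - a + tau * H by lra.
split => //.
have -> : (P + a + tau * H)^-1 + (P - a + tau * H)^-1 =
    2 * (P + tau * H) / D.
  have -> : D = (P + a + tau * H) * (P - a + tau * H) by rewrite /D; ring.
  by field; rewrite !gt_eqF.
have P30 : 0 < P ^+ 3 by rewrite exprn_gt0.
have Dp : 0 < D by nra.
rewrite ler_pdivrMr// -(ler_pM2l P30).
pose Q := 4 * s ^+ 2 - H * P; pose E := 2 * P * H - 4 * s ^+ 2.
have -> : P ^+ 3 * ((2 / P + tau * (2 * (4 * s ^+ 2 - H * P) / P ^+ 3 + 2^-1)) * D)
   = (2 * P ^+ 2 + tau * (2 * Q + P ^+ 3 / 2)) * D.
  by rewrite /Q; field; rewrite gt_eqF.
have DE : D = P ^+ 2 + tau * E + tau ^+ 2 * H ^+ 2.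
  by rewrite /D a2 /E; ring.
rewrite -subr_ge0.
have -> : (2 * P ^+ 2 + tau * (2 * Q + P ^+ 3 / 2)) * D
   - P ^+ 3 * (2 * (P + tau * H)) =
   tau * (2 * tau * (H * P) ^+ 2 + 2 * tau * (Q * E)
     + 2 * tau * (tau * (Q * H ^+ 2)) + D * P ^+ 3 / 2).
  have -> : Q = P * H - E by rewrite /Q /E; ring.
  by rewrite DE; ring.
apply: mulr_ge0 => //.
have PH0 : 0 <= P * H by rewrite mulr_ge0// ltW.
have s0 : 0 <= s ^+ 2 by exact: sqr_ge0.
have QE : - 6 * (P * H) ^+ 2 <= Q * E.
  have -> : Q * E = - 6 * (P * H) ^+ 2
     + 4 * (P * H - s ^+ 2) * (P * H + 4 * s ^+ 2).
    by rewrite /Q /E; ring.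
  by rewrite lerDl !mulr_ge0//; lra.
have QH : - (P * H) * H ^+ 2 <= Q * H ^+ 2.
  by apply: ler_wpM2r; [exact: sqr_ge0 | rewrite /Q; nra].
have QH' : - (P * H) ^+ 2 / 8 <= tau * (Q * H ^+ 2).
  apply: le_trans (ler_wpM2l tau0 QH).
  have -> : tau * (- (P * H) * H ^+ 2) = - (tau * H) * (P * H ^+ 2) by ring.
  have PH2 : 0 <= P * H ^+ 2 by rewrite mulr_ge0 ?sqr_ge0// ltW.
  have -> : - (P * H) ^+ 2 / 8 = - (P / 8) * (P * H ^+ 2) by field.
  by apply: ler_wpM2r => //; lra.
have DP : P ^+ 2 / 2 * P ^+ 3 <= D * P ^+ 3 by apply: ler_wpM2r => //; exact: ltW.
have T1 := ler_wpM2l tau0 QE.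
have T2 := ler_wpM2l tau0 QH'.
have P2 : 0 <= P ^+ 2 by exact: sqr_ge0.
have T3 := ler_wpM2r P2 tH2.
have -> : 2 * tau * (H * P) ^+ 2 + 2 * tau * (Q * E)
     + 2 * tau * (tau * (Q * H ^+ 2)) + D * P ^+ 3 / 2 =
  2 * (tau * (P * H) ^+ 2) + 2 * (tau * (Q * E)) + 2 * (tau * (tau * (Q * H ^+ 2)))
  + (D * P ^+ 3) / 2 by ring.
have e1 : tau * (-6 * (P * H) ^+ 2) = - 6 * (tau * H ^+ 2 * P ^+ 2) by ring.
have e2 : tau * (- (P * H) ^+ 2 / 8) = - (tau * H ^+ 2 * P ^+ 2) / 8 by field.
have e3 : tau * (P * H) ^+ 2 = tau * H ^+ 2 * P ^+ 2 by ring.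
have e4 : P ^+ 2 / 2 * P ^+ 3 = P ^+ 3 * P ^+ 2 / 2 by field.
have e5 : 50 * (tau * H ^+ 2) * P ^+ 2 = 50 * (tau * H ^+ 2 * P ^+ 2) by ring.
have X0 : 0 <= tau * H ^+ 2 * P ^+ 2 by exact: mulr_ge0 (mulr_ge0 tau0 (sqr_ge0 _)) (sqr_ge0 _).
rewrite e1 in T1; rewrite e2 in T2; rewrite e3; rewrite e4 in DP; rewrite e5 in T3.
lra.
Qed.

End InverseSquare.

(** * Comparison of lower integrals *)

Section LowerIntegral.
Context d (T : measurableType d) (R : realType) (mu : {measure set T -> \bar R}).
Import HBNNSimple.
Local Open Scope ereal_scope.

(** Both integrals are suprema over simple functions, and those below f are below g. *)
Lemma ge0_le_lower_integral (f g : T -> \bar R) :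
  (forall x, 0 <= f x) -> (forall x, f x <= g x) ->
  \int[mu]_x f x <= \int[mu]_x g x.
Proof.
move=> f0 fg.
rewrite !ge0_integralTE//; last by move=> x; exact: le_trans (fg x).
apply: le_ereal_sup => _ [h /= hf <-]; exists h => // x.
exact: le_trans (hf x) (fg x).
Qed.

Lemma nnsfun_approx_integral (f : T -> \bar R) (c : R) :
  (forall x, 0 <= f x) -> c%:E < \int[mu]_x f x ->
  exists h : {nnsfun T >-> R},
    (forall x, (h x)%:E <= f x) /\ c%:E < \int[mu]_x (h x)%:E.
Proof.
move=> f0; rewrite ge0_integralTE// => /ereal_sup_gt[_ [h /= hf <-] ch].
by exists h; split => //; rewrite integral_nnsfun// patch_setT.
Qed.

(** Choose simple functions h_i below the g_i whose integrals almost reach that of f. Then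
(sum h_i + a 1_A - b 1_B)^+ / n is measurable and below f, so its integral is at most
that of f, and it can be split since all its terms are measurable. In this way the
inequality sum g_i + a 1_A <= n f + b 1_B is integrated although only the lower
integrals of f and of the g_i make sense. *)
Lemma measure_le_of_minimal (n : nat) (f : T -> \bar R)
    (g : 'I_n -> T -> \bar R) (A B : set T) (a b alpha beta : R) :
  (0 < n)%N -> measurable A -> measurable B ->
  mu A = alpha%:E -> mu B = beta%:E -> (0 <= a)%R -> (0 <= b)%R ->
  (forall x, 0 <= f x) -> (forall i x, 0 <= g i x) ->
  (forall x, \sum_(i < n) g i x + (a * \1_A x)%:E
             <= n%:R%:E * f x + (b * \1_B x)%:E) ->
  (forall i, \int[mu]_x f x <= \int[mu]_x g i x) ->
  \int[mu]_x f x < +oo ->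
  (a * alpha <= b * beta)%R.
Proof.
move=> n0 mA mB Aa Bb a0 b0 f0 g0 fg minf foo.
have nR : (0 < n%:R :> R)%R by rewrite ltr0n.
have f00 : 0 <= \int[mu]_x f x by exact: integral_ge0.
have Jf : \int[mu]_x f x = (fine (\int[mu]_x f x))%:E.
  by rewrite fineK// ge0_fin_numE.
set J := fine _ in Jf.
apply/ler_addgt0Pr => e e0.
(* The n approximations lose at most e in total. *)
pose del := (e / n%:R)%R.
have del0 : (0 < del)%R by rewrite divr_gt0.
have /choice[h hP] i : exists h : {nnsfun T >-> R},
    (forall x, (h x)%:E <= g i x) /\ (J - del)%:E < \int[mu]_x (h x)%:E.
  apply: nnsfun_approx_integral => //.
  by rewrite (lt_le_trans _ (minf i))// Jf lte_fin ltrBlDr ltrDl.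
pose S x := (\sum_(i < n) h i x + a * \1_A x)%R.
pose k x := (Num.max 0 (S x - b * \1_B x) / n%:R)%R.
have S0 x : (0 <= S x)%R.
  by rewrite addr_ge0 ?mulr_ge0// sumr_ge0// => i _; exact: fun_ge0.
have k0 x : (0 <= k x)%R by rewrite divr_ge0// le_max lexx.
have kf x : (k x)%:E <= f x.
  have [foo'|] := eqVneq (f x) +oo; first by rewrite foo' leey.
  rewrite -ltey => fxoo.
  have fx : f x = (fine (f x))%:E by rewrite fineK// ge0_fin_numE.
  have := le_trans (leeD2r (a * \1_A x)%:E
    (lee_sum (index_enum 'I_n) (fun i (_ : true) => (hP i).1 x))) (fg x).
  rewrite fx sumEFin -!(EFinD,EFinM) !lee_fin => Sf.
  rewrite /k ler_pdivrMr// ge_max.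
  rewrite mulr_ge0//=; last exact: fine_ge0.
  by rewrite lerBlDr [X in (_ <= X + _)%R]mulrC.
have mI (E : set T) (c : R) : measurable E ->
    measurable_fun setT (fun x => c * \1_E x)%R.
  by move=> mE; apply: measurable_funM => //; exact: measurable_indic.
have mS : measurable_fun setT S.
  apply: measurable_funD; last exact: mI.
  by apply: measurable_sum => i; exact: measurable_funTS.
have mk : measurable_fun setT k.
  apply: measurable_funM => //; apply: measurable_maxr => //.
  by apply: measurable_funB => //; exact: mI.
have intI (E : set T) (c s : R) : measurable E -> (0 <= c)%R ->
    mu E = s%:E -> \int[mu]_x (c * \1_E x)%:E = (c * s)%:E.
  move=> mE c0 Es; under eq_integral do rewrite EFinM.
  rewrite ge0_integralZl_EFin//; last first.
    by apply/measurable_EFinP; exact: measurable_indic.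
  by rewrite integral_indic// setIT Es.
have kJ : \int[mu]_x (k x)%:E <= J%:E.
  by rewrite -Jf; apply: ge0_le_lower_integral => // x; rewrite lee_fin.
have : \int[mu]_x (S x)%:E <= \int[mu]_x (n%:R * k x + b * \1_B x)%:E.
  apply: ge0_le_integral => //.
  - by move=> x _; rewrite lee_fin.
  - exact/measurable_EFinP.
  - apply/measurable_EFinP; apply: measurable_funD; last exact: mI.
    exact: measurable_funM.
  - move=> x _; rewrite lee_fin /k mulrC divfK ?gt_eqF//.
    by rewrite -lerBlDr le_max lexx orbT.
rewrite /S; under eq_integral do rewrite EFinD -sumEFin.
rewrite ge0_integralD//; last 4 first.
- by move=> x _; apply: sume_ge0 => i _; rewrite lee_fin; exact: fun_ge0.
- under eq_fun do rewrite sumEFin.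
  by apply/measurable_EFinP; apply: measurable_sum => i; exact: measurable_funTS.
- by move=> x _; rewrite lee_fin mulr_ge0.
- by apply/measurable_EFinP; exact: mI.
rewrite (intI _ _ alpha)// ge0_integral_sum//; last 2 first.
- by move=> i; apply/measurable_EFinP; exact: measurable_funTS.
- by move=> i x _; rewrite lee_fin; exact: fun_ge0.
under [X in _ <= X -> _]eq_integral do rewrite EFinD EFinM.
rewrite ge0_integralD//; last 4 first.
- by move=> x _; rewrite mule_ge0// lee_fin.
- by apply/measurable_EFinP; exact: measurable_funM.
- by move=> x _; rewrite lee_fin mulr_ge0.
- by apply/measurable_EFinP; exact: mI.
rewrite (intI _ _ beta)// ge0_integralZl_EFin//; last 2 first.
- by move=> x _; rewrite lee_fin.
- exact/measurable_EFinP.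
move=> main.
have lo : (n%:R * (J - del))%:E <= \sum_(i < n) \int[mu]_x (h i x)%:E.
  have -> : (n%:R * (J - del))%:E = \sum_(i < n) (J - del)%:E.
    by rewrite sumEFin sumr_const card_ord mulr_natl.
  by apply: lee_sum => i _; exact: ltW (hP i).2.
have up : n%:R%:E * \int[mu]_x (k x)%:E + (b * beta)%:E
    <= (n%:R * J + b * beta)%:E.
  by rewrite EFinD leeD2r// EFinM; apply: lee_wpmul2l.
have := le_trans (le_trans (leeD2r _ lo) main) up.
rewrite -EFinD lee_fin /del mulrBr mulrCA mulfV ?gt_eqF// mulr1; lra.
Qed.

End LowerIntegral.

(** * Mean values and derivatives *)

Section Calculus.
Context (R : realType).
Implicit Types (p q v w : R * R) (f : R * R -> R).

(** The endpoints come in either order. *)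
Lemma MVT_between (f df : R -> R) (a b : R) :
  (forall x, Num.min a b <= x <= Num.max a b -> is_derive x 1 f (df x)) ->
  exists2 c, Num.min a b <= c <= Num.max a b & f b - f a = df c * (b - a).
Proof.
wlog ab : a b / a <= b => [hw fdf|].
  case/orP: (le_total a b) => [ab|ba]; first exact: hw.
  have [|c cab fab] := hw b a ba; first by rewrite minC maxC.
  by exists c; [rewrite minC maxC|rewrite -opprB fab -mulrN opprB].
rewrite min_l// max_r// => fdf.
have [||c cab fab] := @MVT_segment R f df a b ab.
- by move=> x xab; apply: fdf; rewrite !(itvP xab).
- apply: derivable_within_continuous => x xab.
  have /fdf[] // : a <= x <= b by rewrite !(itvP xab).
- by exists c => //; rewrite !(itvP cab).
Qed.

Lemma is_derive_of_remainder (V : normedModType R) (f : V -> R) (p v : V) (l : R) :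
  (forall e, 0 < e -> exists2 d, 0 < d &
     forall h, `|h| < d -> `|f (p + h *: v) - f p - h * l| <= e * `|h|) ->
  is_derive p v f l.
Proof.
move=> rem.
have flim : (fun h => h^-1 *: ((f \o shift p) (h *: v) - f p)) @ 0^' --> l.
  apply/cvgrPdist_le => e /rem[d d0 hd].
  near=> h.
  have h0 : h != 0 by near: h; exact: nbhs_dnbhs_neq.
  rewrite /= distrC.
  have -> : h^-1 *: (f (h *: v + p) - f p) - l =
      h^-1 * (f (p + h *: v) - f p - h * l).
    by rewrite [p + _]addrC mulrBr mulKf.
  rewrite normrM normfV ler_pdivrMl ?normr_gt0// [leRHS]mulrC.
  apply: hd; near: h; apply: dnbhs0_lt => //.
split; first by apply/cvg_ex; exists l.
exact/cvg_lim.
Unshelve. all: by end_near. Qed.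

End Calculus.

(** * Functions with Lipschitz gradient on the disk *)

Section C11.
Context (R : realType).
Implicit Types (p q v w : R * R) (f : R * R -> R) (g : R * R -> R * R).

Definition dot v w : R := v.1 * w.1 + v.2 * w.2.

Lemma fstD v w : (v + w).1 = v.1 + w.1. Proof. by []. Qed.
Lemma sndD v w : (v + w).2 = v.2 + w.2. Proof. by []. Qed.
Lemma fstN v : (- v).1 = - v.1. Proof. by []. Qed.
Lemma sndN v : (- v).2 = - v.2. Proof. by []. Qed.
Lemma fstZ (a : R) v : (a *: v).1 = a * v.1. Proof. by []. Qed.
Lemma sndZ (a : R) v : (a *: v).2 = a * v.2. Proof. by []. Qed.
Definition pairE := (fstD, sndD, fstN, sndN, fstZ, sndZ).

Lemma sqnorm_ge0 v : 0 <= sqnorm v.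
Proof. by rewrite addr_ge0 ?sqr_ge0. Qed.

Lemma sqnorm_gt0 v : v != 0 -> 0 < sqnorm v.
Proof.
move=> v0; rewrite lt_neqAle sqnorm_ge0 andbT eq_sym.
apply: contra v0; rewrite /sqnorm paddr_eq0 ?sqr_ge0// !sqrf_eq0.
by case: v => a b /= /andP[/eqP-> /eqP->].
Qed.

Lemma dot_sqr_le v w : dot v w ^+ 2 <= sqnorm v * sqnorm w.
Proof.
rewrite -subr_ge0.
have -> : sqnorm v * sqnorm w - dot v w ^+ 2 = (v.1 * w.2 - v.2 * w.1) ^+ 2.
  by rewrite /sqnorm /dot; ring.
exact: sqr_ge0.
Qed.

Lemma norm_dot_le v w (c : R) :
  `|v.1| <= c -> `|v.2| <= c -> `|dot v w| <= c * (`|w.1| + `|w.2|).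
Proof.
move=> v1 v2; rewrite (le_trans (ler_normD _ _))// !normrM mulrDr.
by rewrite lerD// ler_wpM2r.
Qed.

(** [g] is the gradient of [f], and [C] bounds [f], the components of [g] and
the remainder of the Taylor formula of order one. This two-point form suits
convexity, because the linear terms cancel in a convex combination. *)
Definition C11 (f : R * R -> R) (g : R * R -> R * R) (C : R) :=
  forall p q, Omega p -> Omega q ->
    [/\ `|f p| <= C, `|(g p).1| <= C, `|(g p).2| <= C &
        `|f q - f p - dot (g p) (q - p)| <= C * sqnorm (q - p)].

Lemma Omega_coord p : Omega p -> `|p.1| <= 1 /\ `|p.2| <= 1.
Proof.
rewrite /Omega/= => h; have := sqr_ge0 p.1; have := sqr_ge0 p.2 => h1 h2.
by split; rewrite -(expr_le1 (n:=2))// real_normK ?num_real//; lra.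
Qed.

(** The remainder is quadratic, hence Lipschitz because the disk is bounded. *)
Lemma C11_lip f g C p q : C11 f g C -> Omega p -> Omega q ->
  `|f q - f p| <= 3 * C * (`|q.1 - p.1| + `|q.2 - p.2|).
Proof.
move=> fC Op Oq; have [fp g1 g2 fq] := fC _ _ Op Oq.
have C0 : 0 <= C by exact: le_trans fp.
have -> : f q - f p = (f q - f p - dot (g p) (q - p)) + dot (g p) (q - p) by ring.
rewrite (le_trans (ler_normD _ _))//.
have := norm_dot_le _ (q - p) _ g1 g2; rewrite !pairE => dle.
have [p1 p2] := Omega_coord _ Op; have [q1 q2] := Omega_coord _ Oq.
have qp1 : `|q.1 - p.1| <= 2 by rewrite (le_trans (ler_normB _ _))//; lra.
have qp2 : `|q.2 - p.2| <= 2 by rewrite (le_trans (ler_normB _ _))//; lra.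
have sq : sqnorm (q - p) <= 2 * (`|q.1 - p.1| + `|q.2 - p.2|).
  rewrite /sqnorm !pairE -(real_normK (num_real (q.1 - p.1))).
  rewrite -(real_normK (num_real (q.2 - p.2))).
  move: qp1 qp2; set x := `|q.1 - _|; set y := `|q.2 - _| => qp1 qp2.
  have x0 : 0 <= x by exact: normr_ge0.
  have y0 : 0 <= y by exact: normr_ge0.
  nra.
have := ler_wpM2l C0 sq; lra.
Qed.

(** The remainder of the product is f1 times the remainder of f2, plus f2 times that
of f1, plus the product of the two increments, which is quadratic by
[C11_lip]. *)
Lemma C11M f1 g1 C1 f2 g2 C2 : C11 f1 g1 C1 -> C11 f2 g2 C2 ->
  C11 (fun p => f1 p * f2 p) (fun p => f1 p *: g2 p + f2 p *: g1 p)
    (20 * (C1 * C2)).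
Proof.
move=> h1 h2 p q Op Oq.
have [f1p g11 g12 f1q] := h1 _ _ Op Oq.
have [f2p g21 g22 f2q] := h2 _ _ Op Oq.
have C10 : 0 <= C1 by exact: le_trans f1p.
have C20 : 0 <= C2 by exact: le_trans f2p.
have CC : 0 <= C1 * C2 by exact: mulr_ge0.
have gle (x y z w : R) : `|x| <= C1 -> `|y| <= C2 -> `|z| <= C2 -> `|w| <= C1 ->
    `|x * y + z * w| <= 20 * (C1 * C2).
  move=> x1 y1 z1 w1; rewrite (le_trans (ler_normD _ _))// !normrM.
  have := ler_pM (normr_ge0 _) (normr_ge0 _) x1 y1.
  have := ler_pM (normr_ge0 _) (normr_ge0 _) z1 w1; lra.
split; rewrite ?pairE; [|exact: gle..|].
  by rewrite normrM; have := ler_pM (normr_ge0 _) (normr_ge0 _) f1p f2p; lra.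
have L1 := C11_lip _ _ _ _ _ h1 Op Oq.
have L2 := C11_lip _ _ _ _ _ h2 Op Oq.
have -> : f1 q * f2 q - f1 p * f2 p
    - dot (f1 p *: g2 p + f2 p *: g1 p) (q - p) =
  f1 p * (f2 q - f2 p - dot (g2 p) (q - p))
  + f2 p * (f1 q - f1 p - dot (g1 p) (q - p))
  + (f1 q - f1 p) * (f2 q - f2 p).
  by rewrite /dot !pairE; ring.
set x := f1 p * _; set y := f2 p * _; set w := (f1 q - _) * _.
have T1 : `|x| <= C1 * (C2 * sqnorm (q - p)) by rewrite normrM ler_pM.
have T2 : `|y| <= C2 * (C1 * sqnorm (q - p)) by rewrite normrM ler_pM.
have := ler_pM (normr_ge0 _) (normr_ge0 _) L1 L2.
rewrite -normrM -/w.
have S : (`|q.1 - p.1| + `|q.2 - p.2|) ^+ 2 <= 2 * sqnorm (q - p).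
  rewrite /sqnorm !pairE -(real_normK (num_real (q.1 - p.1))).
  rewrite -(real_normK (num_real (q.2 - p.2))).
  set a := `|_ - _|; set b := `|_ - _|; have := sqr_ge0 (a - b); lra.
have := ler_wpM2l CC S; move: T1 T2.
set z := `|_| + `|_|; set s := sqnorm _ => T1 T2 S' T3.
have e3 : 3 * C1 * z * (3 * C2 * z) = 9 * (C1 * C2 * z ^+ 2) by ring.
rewrite (le_trans (ler_normD _ _))// (le_trans (lerD (ler_normD _ _) (lexx _)))//.
rewrite (le_trans (lerD (lerD T1 T2) T3))// e3; lra.
Qed.

Lemma C11_ridge (f df : R -> R) (a : R * R) (M C : R) :
  (forall p, Omega p -> `|dot a p| <= M) ->
  (forall s t, `|s| <= M -> `|t| <= M ->
     [/\ `|f s| <= C, `|df s| <= C &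
         `|f t - f s - df s * (t - s)| <= C * (t - s) ^+ 2]) ->
  C11 (fun p => f (dot a p)) (fun p => df (dot a p) *: a)
    (C * (1 + sqnorm a)).
Proof.
move=> aM fM p q Op Oq.
have [fp dfp fq] := fM _ _ (aM _ Op) (aM _ Oq).
have C0 : 0 <= C by exact: le_trans fp.
have sa : 0 <= C * sqnorm a by rewrite mulr_ge0 ?sqnorm_ge0.
have ac (x : R) : x ^+ 2 <= sqnorm a -> `|x| <= 1 + sqnorm a.
  move=> xa; rewrite -(real_normK (num_real x)) in xa.
  have := sqr_ge0 (`|x| - 1); have := normr_ge0 x; nra.
have gle (x : R) : x ^+ 2 <= sqnorm a ->
    `|df (dot a p) * x| <= C * (1 + sqnorm a).
  by move=> /ac xa; rewrite normrM; exact: ler_pM.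
have s1 := sqr_ge0 a.1; have s2 := sqr_ge0 a.2.
split; rewrite ?pairE.
- by rewrite mulrDr mulr1; lra.
- by apply: gle; rewrite /sqnorm; lra.
- by apply: gle; rewrite /sqnorm; lra.
have daq : dot a q - dot a p = dot a (q - p) by rewrite /dot !pairE; ring.
have -> : dot (df (dot a p) *: a) (q - p) = df (dot a p) * (dot a q - dot a p).
  by rewrite daq /dot !pairE; ring.
rewrite (le_trans fq)// daq -mulrA ler_wpM2l//.
rewrite (le_trans (dot_sqr_le _ _))// ler_wpM2r ?sqnorm_ge0//; lra.
Qed.

(** The balls of the product norm are squares. *)
Lemma nbhs_osquareP p (A : set (R * R)) :
  nbhs p A <-> exists2 d, 0 < d &
    forall q, `|q.1 - p.1| < d -> `|q.2 - p.2| < d -> A q.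
Proof.
rewrite nbhs_ballP; split => [[d /= d0 dA]|[d d0 dA]]; exists d => //.
  by move=> q q1 q2; apply: dA; split; rewrite /ball/= distrC.
by move=> q [q1 q2]; apply: dA; rewrite distrC.
Qed.

Lemma nbhs_line p v (A : set (R * R)) : nbhs p A ->
  exists2 d, 0 < d & forall h, `|h| < d -> A (p + h *: v).
Proof.
move=> /nbhs_osquareP[d d0 dA].
have v0 : 0 < 1 + `|v.1| + `|v.2| by rewrite -addrA ltr_wpDr// addr_ge0.
exists (d / (1 + `|v.1| + `|v.2|)); first exact: divr_gt0.
move=> h; rewrite ltr_pdivlMr// => hd.
have := normr_ge0 v.1; have := normr_ge0 v.2; have := normr_ge0 h => h0 v10 v20.
by apply: dA; rewrite !pairE addrC addKr normrM; nra.
Qed.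

Lemma C11_is_derive f g C p v : C11 f g C -> nbhs p (@Omega R) ->
  is_derive p v f (dot (g p) v).
Proof.
move=> fC Op; apply: is_derive_of_remainder => e e0.
have Op' := nbhs_singleton Op.
have [fp _ _ _] := fC _ _ Op' Op'.
have C0 : 0 <= C by exact: le_trans fp.
have [d d0 dO] := nbhs_line _ v _ Op.
have K0 : 0 < 1 + C * sqnorm v by rewrite ltr_wpDr// mulr_ge0// sqnorm_ge0.
exists (Num.min d (e / (1 + C * sqnorm v))).
  by rewrite lt_min d0 divr_gt0.
move=> h; rewrite lt_min ltr_pdivlMr// => /andP[hd he].
have [_ _ _] := fC _ _ Op' (dO _ hd).
have -> : p + h *: v - p = h *: v by rewrite addrC addKr.
have -> : dot (g p) (h *: v) = h * dot (g p) v by rewrite /dot !pairE; ring.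
move=> /le_trans; apply.
have -> : sqnorm (h *: v) = `|h| ^+ 2 * sqnorm v.
  by rewrite real_normK ?num_real// /sqnorm !pairE; ring.
have h0 := normr_ge0 h.
have -> : C * (`|h| ^+ 2 * sqnorm v) = (`|h| * (C * sqnorm v)) * `|h| by ring.
by rewrite ler_wpM2r//; lra.
Qed.

End C11.

Arguments dot {R}.
Arguments C11 {R}.

(** * Sine, cosine and bump functions *)

Section Oscillation.
Context (R : realType).
Implicit Types (p q v w a z : R * R) (f : R * R -> R) (g : R * R -> R * R).

(** The mean value theorem, applied twice. *)
Lemma taylor1 (f df ddf : R -> R) :
  (forall x : R, is_derive x 1 f (df x)) -> (forall x : R, is_derive x 1 df (ddf x)) ->
  (forall x, `|ddf x| <= 1) ->
  forall s t, `|f t - f s - df s * (t - s)| <= (t - s) ^+ 2.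
Proof.
move=> fd dfd dd1 s t.
have [c cst ->] := MVT_between R f df s t (fun x _ => fd x).
have [c' _] := MVT_between R df ddf s c (fun x _ => dfd x).
rewrite -mulrBl => ->; rewrite !normrM -(real_normK (num_real (t - s))).
have cs : `|c - s| <= `|t - s|.
  by move: cst; case: (lerP s t) => st /andP[c1 c2];
    [rewrite !ger0_norm|rewrite !ler0_norm]; lra.
rewrite expr2 ler_wpM2r// (le_trans _ cs)//.
by rewrite ler_piMl.
Qed.

Lemma norm_sin_le1 (x : R) : `|sin x| <= 1.
Proof. by rewrite ler_norml sin_geN1 sin_le1. Qed.

Lemma norm_cos_le1 (x : R) : `|cos x| <= 1.
Proof. by rewrite ler_norml cos_geN1 cos_le1. Qed.

Lemma dot_bounded a p : Omega p -> `|dot a p| <= `|a.1| + `|a.2|.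
Proof.
move=> /Omega_coord[p1 p2]; rewrite (le_trans (ler_normD _ _))// !normrM.
by rewrite lerD// ler_piMr.
Qed.

Lemma C11_sin a : C11 (fun p => sin (dot a p))
  (fun p => cos (dot a p) *: a) (1 + sqnorm a).
Proof.
rewrite -[_ + _]mul1r; apply: (C11_ridge R sin cos a _ _ (dot_bounded a)).
move=> s t _ _; rewrite norm_sin_le1 norm_cos_le1; split => //.
rewrite mul1r; apply: (taylor1 sin cos (- sin)) => x.
by rewrite normrN norm_sin_le1.
Qed.

Lemma C11_cos a : C11 (fun p => cos (dot a p))
  (fun p => (- sin (dot a p)) *: a) (1 + sqnorm a).
Proof.
rewrite -[_ + _]mul1r.
apply: (C11_ridge R cos (- sin : R -> R) a _ _ (dot_bounded a)).
move=> s t _ _; rewrite normrN norm_sin_le1 norm_cos_le1; split => //.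
rewrite mul1r; apply: (taylor1 cos (- sin) (fun x => - cos x)) => x.
by rewrite normrN norm_cos_le1.
Qed.

Definition pospart (x : R) := Num.max 0 x.

Lemma pospart_cases x : 0 <= x /\ pospart x = x \/ x <= 0 /\ pospart x = 0.
Proof.
by rewrite /pospart; case: (lerP 0 x) => x0; [left|right; split => //; exact: ltW].
Qed.

Definition bump1 (r c x : R) := pospart (r ^+ 2 - (x - c) ^+ 2) ^+ 2.
(** The derivative of [bump1]. *)
Definition dbump1 (r c x : R) := - 4 * (x - c) * pospart (r ^+ 2 - (x - c) ^+ 2).

(** The square of the positive part has derivative 2 pospart w, which is
2-Lipschitz. *)
Lemma sqr_pospart_remainder (w k : R) :
  0 <= pospart (w + k) ^+ 2 - pospart w ^+ 2 - 2 * pospart w * k <= k ^+ 2.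
Proof.
by have [[h1 ->]|[h1 ->]] := pospart_cases w; have [[h2 ->]|[h2 ->]] := pospart_cases (w + k);
  apply/andP; split; nra.
Qed.

Lemma bump1_C11 (r c : R) : 0 < r -> r <= 1 -> `|c| <= 1 ->
  forall s t, `|s| <= 1 -> `|t| <= 1 ->
  [/\ `|bump1 r c s| <= 20, `|dbump1 r c s| <= 20 &
  `|bump1 r c t - bump1 r c s - dbump1 r c s * (t - s)| <= 20 * (t - s) ^+ 2].
Proof.
move=> r0 r1; rewrite ler_norml => /andP[c1 c2] s t.
rewrite !ler_norml => /andP[s1 s2] /andP[t1 t2].
rewrite /bump1 /dbump1; set ws := r ^+ 2 - (s - c) ^+ 2.
have wt : r ^+ 2 - (t - c) ^+ 2 = ws + (- 2 * (s - c) * (t - s) - (t - s) ^+ 2).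
  by rewrite /ws; ring.
have pws : 0 <= pospart ws <= 1.
  have [[h1 ->]|[h1 ->]] := pospart_cases ws; rewrite ?lexx ?ler01// h1/= /ws.
  by have := sqr_ge0 (s - c); nra.
case/andP: pws => p0 p1; rewrite wt.
set k := - 2 * _ * _ - _.
have kE : k ^+ 2 = (t - s) ^+ 2 * (t + s - 2 * c) ^+ 2 by rewrite /k; ring.
have kle : k ^+ 2 <= 16 * (t - s) ^+ 2.
  rewrite kE mulrC ler_wpM2r ?sqr_ge0//.
  have -> : 16 = 4 ^+ 2 :> R by ring.
  by rewrite -[leLHS]real_normK ?num_real// ler_pXn2r ?nnegrE// ler_norml; lra.
have /andP[k1 k2] := sqr_pospart_remainder ws k.
have ts0 := sqr_ge0 (t - s).
split.
- by apply/andP; split; nra.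
- have sc : -2 <= s - c <= 2 by lra.
  by case/andP: sc => sc1 sc2; apply/andP; split; nra.
have -> : pospart (ws + k) ^+ 2 - pospart ws ^+ 2 - - 4 * (s - c) * pospart ws * (t - s) =
   (pospart (ws + k) ^+ 2 - pospart ws ^+ 2 - 2 * pospart ws * k)
   - 2 * pospart ws * (t - s) ^+ 2.
  by rewrite /k; ring.
move: k1 k2; set X := pospart (ws + k) ^+ 2 - _ - _ => k1 k2.
have : 0 <= pospart ws * (t - s) ^+ 2 <= (t - s) ^+ 2.
  by rewrite mulr_ge0//= ler_piMl.
by case/andP => q1 q2; apply/andP; split; lra.
Qed.

Definition bump2 (r : R) z p := bump1 r z.1 p.1 * bump1 r z.2 p.2.
(** The gradient of [bump2]. *)
Definition dbump2 (r : R) z p :=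
  (dbump1 r z.1 p.1 * bump1 r z.2 p.2, bump1 r z.1 p.1 * dbump1 r z.2 p.2).

Lemma bump2_C11 (r : R) z : 0 < r -> r <= 1 -> Omega z ->
  exists C, C11 (bump2 r z) (dbump2 r z) C.
Proof.
move=> r0 r1 /Omega_coord[z1 z2].
have d1 p : Omega p -> `|dot (1, 0) p| <= 1.
  by move=> /Omega_coord[? _]; rewrite /dot/= mul1r mul0r addr0.
have d2 p : Omega p -> `|dot (0, 1) p| <= 1.
  by move=> /Omega_coord[_ ?]; rewrite /dot/= mul1r mul0r add0r.
have := C11M R _ _ _ _ _ _
  (C11_ridge R _ _ _ _ _ d1 (bump1_C11 r z.1 r0 r1 z1))
  (C11_ridge R _ _ _ _ _ d2 (bump1_C11 r z.2 r0 r1 z2)).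
set C := (X in C11 _ _ X) => h; exists C; move: h; congr (C11 _ _ _).
  by apply/funext => p; rewrite /dot/= !mul1r !mul0r addr0 add0r.
apply/funext => p; rewrite /dot/= !mul1r !mul0r addr0 add0r /dbump2.
by apply/pair_equal_spec; split; rewrite /= /GRing.scale/=; ring.
Qed.

End Oscillation.

Arguments pospart {R}.
Arguments bump1 {R}.
Arguments dbump1 {R}.
Arguments bump2 {R}.
Arguments dbump2 {R}.

(** * Functions with continuous partial derivatives *)

(** The numbers fp, fm, fq are the values at the vertices of a path along the axes, with
G1 and G2 the partial derivatives given by the mean value theorem on its sides. *)
Lemma axis_path_remainder (R : realType) (fq fm fp G1 G2 g1 g2 h v1 v2 e : R) :
  0 < e -> fq - fm = G1 * (h * v1) -> fm - fp = G2 * (h * v2) ->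
  `|G1 - g1| <= e / (1 + `|v1| + `|v2|) ->
  `|G2 - g2| <= e / (1 + `|v1| + `|v2|) ->
  `|fq - fp - h * (g1 * v1 + g2 * v2)| <= e * `|h|.
Proof.
move=> e0 e1 e2; set c := 1 + _ + _ => d1 d2.
have n1 := normr_ge0 v1; have n2 := normr_ge0 v2; have h0 := normr_ge0 h.
have c0 : 0 < c by rewrite /c; lra.
have -> : fq - fp - h * (g1 * v1 + g2 * v2) =
    (G1 - g1) * (h * v1) + (G2 - g2) * (h * v2).
  have -> : fq - fp = (fq - fm) + (fm - fp) by ring.
  by rewrite e1 e2; ring.
rewrite (le_trans (ler_normD _ _))// !normrM.
have -> : e * `|h| = e / c * (c * `|h|) by field; rewrite gt_eqF.
have := ler_wpM2r (mulr_ge0 h0 n1) d1.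
have := ler_wpM2r (mulr_ge0 h0 n2) d2.
have : 0 <= e / c * `|h| by rewrite mulr_ge0// divr_ge0// ltW.
set E := e / c; rewrite /c; lra.
Qed.

Section PartialDerivatives.
Context (R : realType) (omega : set (R * R)) (omega_open : open omega).
Implicit Types (p q v h x y z : R * R) (f u : R * R -> R).

Definition C1_on f := forall (i : 'I_2) p, omega p ->
  derivable f p (stdvec R i) /\ {for p, continuous ('D_(stdvec R i) f)}.

Lemma Cn_on2_C1 u : Cn_on 2 omega u ->
  [/\ forall p, omega p -> {for p, continuous u}, C1_on u &
      forall i, C1_on ('D_(stdvec R i) u)].
Proof.
move=> [uc uD]; split => //.
  by move=> i p wp; have [h1 [h2 _]] := uD i; split; [exact: h1|exact: h2].
move=> i j p wp; have [_ [_ /(_ j)[h1 [h2 _]]]] := uD i.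
by split; [exact: h1|exact: h2].
Qed.

(** Both difference quotients are the same function. *)
Lemma is_derive_line (f : R * R -> R) p v (s l : R) :
  is_derive (p + s *: v) v f l ->
  is_derive s 1 (fun t : R => f (p + t *: v)) l.
Proof.
have E : (fun h : R => h^-1 *: ((f \o shift (p + s *: v)) (h *: v)
             - f (p + s *: v))) =
    (fun h : R => h^-1 *: (((fun t : R => f (p + t *: v)) \o shift s) (h *: 1)
             - f (p + s *: v))).
  apply/funext => h /=; congr (_ *: (f _ - _)).
  by rewrite addrCA -scalerDl [h *: 1]mulr1.
case=> + <-; rewrite /derivable /derive E => fd.
by split; rewrite /derivable /derive.
Qed.

Lemma continuous_near f p (e : R) : {for p, continuous f} -> 0 < e ->
  nbhs p [set q | `|f q - f p| < e].
Proof.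
move=> fc e0; have /cvgrPdist_lt/(_ e e0) : f q @[q --> p] --> f p by exact: fc.
by apply: filterS => q; rewrite /= distrC.
Qed.

Lemma grad_near f p (e : R) : C1_on f -> omega p -> 0 < e ->
  nbhs p [set q | omega q /\
    `|(grad f q).1 - (grad f p).1| < e /\ `|(grad f q).2 - (grad f p).2| < e].
Proof.
move=> fC wp e0.
have wn : nbhs p omega by exact: open_nbhs_nbhs.
have [_ /continuous_near/(_ e0) n1] := fC ord0 _ wp.
have [_ /continuous_near/(_ e0) n2] := fC ord_max _ wp.
apply: filterS3 wn n1 n2 => q wq q1 q2.
by split; [exact: wq|split; [exact: q1|exact: q2]].
Qed.

Lemma between_norm (a c : R) : Num.min 0 a <= c <= Num.max 0 a -> `|c| <= `|a|.
Proof.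
by case: (lerP 0 a) => a0 /andP[c1 c2];
  [rewrite !ger0_norm|rewrite !ler0_norm]; lra.
Qed.

(** Go from p to p + h v parallel to the axes, first vertically and then
horizontally; the mean value theorem on each side gives partial derivatives at
points close to p. *)
Lemma C1_is_derive f p v : C1_on f -> omega p ->
  is_derive p v f (dot (grad f p) v).
Proof.
move=> fC wp; apply: is_derive_of_remainder => e e0.
have v0 : 0 < 1 + `|v.1| + `|v.2| by rewrite -addrA ltr_wpDr// addr_ge0.
set c := 1 + _ + _ in v0.
have ec : 0 < e / c by exact: divr_gt0.
have /nbhs_osquareP[d d0 dP] := grad_near _ _ _ fC wp ec.
exists (d / c); first exact: divr_gt0.
move=> h; rewrite ltr_pdivlMr// => hd.
have v1 := normr_ge0 v.1; have v2 := normr_ge0 v.2; have h0 := normr_ge0 h.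
have hv1 : `|h * v.1| < d by rewrite normrM; move: hd; rewrite /c; nra.
have hv2 : `|h * v.2| < d by rewrite normrM; move: hd; rewrite /c; nra.
pose m := p + (h * v.2) *: stdvec R ord_max.
have mE : m = (p.1, p.2 + h * v.2).
  by apply/pair_equal_spec; split; rewrite /= /GRing.scale/= ?mulr0 ?addr0// mulr1.
have qE : p + h *: v = m + (h * v.1) *: stdvec R ord0.
  rewrite mE; apply/pair_equal_spec; split; rewrite /= /GRing.scale/=.
    by rewrite mulr1.
  by rewrite mulr0 addr0.
have dom2 (s : R) : `|s| < d -> 
    [/\ omega (p + s *: stdvec R ord_max),
     `|(grad f (p + s *: stdvec R ord_max)).1 - (grad f p).1| < e / c &
     `|(grad f (p + s *: stdvec R ord_max)).2 - (grad f p).2| < e / c].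
  move=> sd; have [||? []] := dP (p + s *: stdvec R ord_max); last by split.
    by rewrite !pairE /= mulr0 addr0 subrr normr0.
  by rewrite !pairE /= mulr1 addrC addKr.
have dom1 (s : R) : `|s| < d -> 
    [/\ omega (m + s *: stdvec R ord0),
     `|(grad f (m + s *: stdvec R ord0)).1 - (grad f p).1| < e / c &
     `|(grad f (m + s *: stdvec R ord0)).2 - (grad f p).2| < e / c].
  move=> sd; have [||? []] := dP (m + s *: stdvec R ord0); last by split.
    by rewrite mE !pairE /= mulr1 addrC addKr.
  by rewrite mE !pairE /= mulr0 addr0 addrC addKr.
have [x xb e1] := MVT_between R (fun s => f (m + s *: stdvec R ord0))
   (fun s => (grad f (m + s *: stdvec R ord0)).1) 0 (h * v.1) (fun s sb =>
   is_derive_line _ _ _ _ _ (derivableP (fC _ _ (let: And3 w _ _ :=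
     dom1 _ (le_lt_trans (between_norm _ _ sb) hv1) in w)).1)).
have [y yb e2] := MVT_between R (fun s => f (p + s *: stdvec R ord_max))
   (fun s => (grad f (p + s *: stdvec R ord_max)).2) 0 (h * v.2) (fun s sb =>
   is_derive_line _ _ _ _ _ (derivableP (fC _ _ (let: And3 w _ _ :=
     dom2 _ (le_lt_trans (between_norm _ _ sb) hv2) in w)).1)).
have [_ + _] := dom1 _ (le_lt_trans (between_norm _ _ xb) hv1).
have [_ _ +] := dom2 _ (le_lt_trans (between_norm _ _ yb) hv2).
move: e1 e2; cbv beta; rewrite !scale0r !addr0 !subr0 -/m -qE.
set G1 := (grad f (m + _)).1; set G2 := (grad f (p + _)).2.
move=> e1 e2 g2 g1.
exact: axis_path_remainder e0 e1 e2 (ltW g1) (ltW g2).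
Qed.

End PartialDerivatives.

Arguments C1_on {R}.

(** * The Hessian quadratic form *)

Lemma bilinear_form_near (R : realType) (A1 A2 C1 C2 B1 B2 D1 D2 x y e : R) :
  `|A1 - B1| <= e / 2 -> `|A2 - B2| <= e / 2 ->
  `|C1 - D1| <= e / 2 -> `|C2 - D2| <= e / 2 ->
  `|(A1 * x + A2 * y) * x + (C1 * x + C2 * y) * y
    - ((B1 * x + B2 * y) * x + (D1 * x + D2 * y) * y)|
    <= e * (x ^+ 2 + y ^+ 2).
Proof.
have -> : (A1 * x + A2 * y) * x + (C1 * x + C2 * y) * y
  - ((B1 * x + B2 * y) * x + (D1 * x + D2 * y) * y) =
  (A1 - B1) * x ^+ 2 + ((A2 - B2) + (C1 - D1)) * (x * y)
  + (C2 - D2) * y ^+ 2 by ring.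
rewrite !ler_norml.
move=> /andP[a1 a1'] /andP[a2 a2'] /andP[b1 b1'] /andP[b2 b2'].
have s1 := sqr_ge0 x; have s2 := sqr_ge0 y.
have hp := sqr_ge0 (x + y); have hm := sqr_ge0 (x - y).
have m1 : `|x * y| <= (x ^+ 2 + y ^+ 2) / 2.
  by rewrite ler_norml; apply/andP; split; lra.
have m2 : `|(A2 - B2 + (C1 - D1)) * (x * y)| <= e * ((x ^+ 2 + y ^+ 2) / 2).
  by rewrite normrM ler_pM// ler_norml; apply/andP; split; lra.
move: m2; rewrite ler_norml => /andP[m2 m2'].
have t1 := ler_wpM2r s1 a1; have t1' := ler_wpM2r s1 a1'.
have t2 := ler_wpM2r s2 b2; have t2' := ler_wpM2r s2 b2'.
apply/andP; split; lra.
Qed.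

Lemma perturbed_lt (R : realType) (H H0 K N : R) : H0 < K -> 0 <= N ->
  `|H - H0| <= (K - H0) / (1 + N) / 2 * N -> H < K.
Proof.
move=> HK N0; have sh : 0 < 1 + N by lra.
rewrite ler_norml => /andP[_].
have -> : (K - H0) / (1 + N) / 2 * N = (K - H0) / 2 * (N / (1 + N)).
  by field; rewrite gt_eqF.
have : N / (1 + N) <= 1 by rewrite ler_pdivrMr//; lra.
have : 0 < K - H0 by rewrite subr_gt0.
set w := _ / _ => k0 w1; nra.
Qed.

(** Here u0, u1, u2 are the values at 0, t, -t of a function on a line, g and g' are
its slopes at x and y, and H is its second derivative between them. *)
Lemma second_difference_contra (R : realType)
    (t K H a x y u0 u1 u2 g g' : R) : 0 < t -> 0 < K -> H < K ->
  y <= x -> x <= t -> - t <= y ->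
  u1 - u0 = g * (t - 0) -> u2 - u0 = g' * (- t - 0) -> g - g' = H * (x - y) ->
  u0 + a * t + K * t ^+ 2 <= u1 -> u0 + a * (- t) + K * t ^+ 2 <= u2 ->
  False.
Proof.
move=> t0 K0 cK yx xt yt e1 e2 e3 T1 T2.
have M : 2 * (K * t ^+ 2) <= t * (H * (x - y)) by rewrite -e3; lra.
have M2 : 2 * K * t <= H * (x - y) by rewrite -(ler_pM2l t0); lra.
have [H0|H0] := lerP H 0; first by nra.
have : H * (x - y) <= H * (2 * t) by apply: ler_wpM2l; [exact: ltW|lra].
nra.
Qed.

Section SecondDerivative.
Context (R : realType) (omega : set (R * R)) (omega_open : open omega).
Context (u : R * R -> R).
Hypothesis uC1 : C1_on omega u.
Hypothesis uC2 : forall i, C1_on omega ('D_(stdvec R i) u).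
Implicit Types (p q v h x y z : R * R).

(** The Hessian form of [u] at [p], with the two mixed derivatives kept apart. *)
Definition hess p h := dot (grad ('D_(stdvec R ord0) u) p) h * h.1
                     + dot (grad ('D_(stdvec R ord_max) u) p) h * h.2.

Lemma dgrad_line p h (s : R) : omega (p + s *: h) ->
  is_derive s 1 (fun t : R => dot (grad u (p + t *: h)) h) (hess (p + s *: h) h).
Proof.
move=> wp.
have d1 := is_derive_line _ _ _ _ _ _
  (C1_is_derive _ _ omega_open _ _ h (uC2 ord0) wp).
have d2 := is_derive_line _ _ _ _ _ _
  (C1_is_derive _ _ omega_open _ _ h (uC2 ord_max) wp).
have -> : (fun t : R => dot (grad u (p + t *: h)) h) =
   (fun t : R => h.1 * 'D_(stdvec R ord0) u (p + t *: h)) +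
   (fun t : R => h.2 * 'D_(stdvec R ord_max) u (p + t *: h)).
  by apply/funext => t; rewrite /dot/= mulrC [X in _ + X]mulrC.
apply: is_derive_eq.
by rewrite /hess /GRing.scale/= mulrC [X in _ + X]mulrC.
Qed.

Lemma u_line p h (s : R) : omega (p + s *: h) ->
  is_derive s 1 (fun t : R => u (p + t *: h)) (dot (grad u (p + s *: h)) h).
Proof. by move=> wp; apply: is_derive_line; exact: C1_is_derive wp. Qed.

Lemma hess_near z (e : R) : omega z -> 0 < e ->
  nbhs z [set x | omega x /\
    forall h, `|hess x h - hess z h| <= e * sqnorm h].
Proof.
move=> wz e0; have e20 : 0 < e / 2 by rewrite divr_gt0.
have n1 := grad_near _ _ omega_open _ _ _ (uC2 ord0) wz e20.
have n2 := grad_near _ _ omega_open _ _ _ (uC2 ord_max) wz e20.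
apply: filterS2 n1 n2 => x [wx [/ltW a1 /ltW a2]] [_ [/ltW b1 /ltW b2]].
split => // h; rewrite /hess /dot.
exact: bilinear_form_near.
Qed.

#[local] Opaque hess.

(** Otherwise the second derivative along the line is less than K near z. By two
applications of the mean value theorem, so is half of
(u (z + t h) + u (z - t h) - 2 u z) / t^2, while the touching condition makes this
quantity at least K. *)
Lemma hess_ge_of_touching z h (a K d : R) : omega z -> 0 < d -> 0 < K ->
  (forall s : R, `|s| < d -> u z + a * s + K * s ^+ 2 <= u (z + s *: h)) ->
  K <= hess z h.
Proof.
move=> wz d0 K0 touch; rewrite leNgt; apply/negP => hK.
have sh : 0 < 1 + sqnorm h by rewrite ltr_wpDr// sqnorm_ge0.
have e0 : 0 < (K - hess z h) / (1 + sqnorm h) / 2 by rewrite !divr_gt0// subr_gt0.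
have [d' d'0 dP] := nbhs_line _ _ h _ (hess_near z _ wz e0).
set t := Num.min d d' / 2.
have t0 : 0 < t by rewrite divr_gt0// lt_min d0.
have td : t < d by rewrite ltr_pdivrMr// gt_min; apply/orP; left; lra.
have td' : t < d' by rewrite ltr_pdivrMr// gt_min; apply/orP; right; lra.
have dom (s : R) : `|s| <= t -> omega (z + s *: h) /\ hess (z + s *: h) h < K.
  move=> st; have [ws /(_ h) b] := dP _ (le_lt_trans st td').
  by split; [exact: ws|exact: perturbed_lt hK (sqnorm_ge0 _ h) b].
have in1 (s : R) : Num.min 0 t <= s <= Num.max 0 t -> `|s| <= t.
  by move=> /between_norm; rewrite (ger0_norm (ltW t0)).
have in2 (s : R) : Num.min 0 (- t) <= s <= Num.max 0 (- t) -> `|s| <= t.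
  by move=> /between_norm; rewrite normrN (ger0_norm (ltW t0)).
have [x xb e1] := MVT_between R (fun s => u (z + s *: h))
   (fun s => dot (grad u (z + s *: h)) h) 0 t
   (fun s sb => u_line z h s (dom s (in1 s sb)).1).
have [y yb e2] := MVT_between R (fun s => u (z + s *: h))
   (fun s => dot (grad u (z + s *: h)) h) 0 (- t)
   (fun s sb => u_line z h s (dom s (in2 s sb)).1).
move: xb yb; rewrite (min_l (ltW t0)) (max_r (ltW t0)).
have t0' : - t <= 0 by rewrite oppr_le0 ltW.
rewrite (min_r t0') (max_l t0') => /andP[x0 xt] /andP[yt y0].
have yx : y <= x by exact: le_trans y0 x0.
have inyx (s : R) : Num.min y x <= s <= Num.max y x -> `|s| <= t.
  rewrite (min_l yx) (max_r yx) ler_norml => /andP[s1 s2].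
  by rewrite (le_trans yt s1) (le_trans s2 xt).
have [c cb e3] := MVT_between R (fun s => dot (grad u (z + s *: h)) h)
   (fun s => hess (z + s *: h) h) y x
   (fun s sb => dgrad_line z h s (dom s (inyx s sb)).1).
have [_ cK] := dom c (inyx c cb).
have T1 : u z + a * t + K * t ^+ 2 <= u (z + t *: h).
  by apply: touch; rewrite gtr0_norm.
have T2 : u z + a * (- t) + K * (- t) ^+ 2 <= u (z + (- t) *: h).
  by apply: touch; rewrite normrN gtr0_norm.
move: e1 e2 e3 T1 T2; cbv beta; rewrite scale0r addr0 sqrrN => e1 e2 e3 T1 T2.
exact: second_difference_contra cK yx xt yt e1 e2 e3 T1 T2.
Qed.

End SecondDerivative.

Arguments hess {R}.

(** * A paraboloid touching a strictly convex function from below *)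

Section Touching.
Context (R : realType) (omega : set (R * R)) (omega_open : open omega).
Context (u : R * R -> R).
Hypothesis uC : forall p, omega p -> {for p, continuous u}.
Hypothesis uC1 : C1_on omega u.
Implicit Types (p q v h x y z : R * R).
#[local] Opaque hess grad.

Lemma is_derive_le (F : R -> R) (l M d : R) : 0 < d -> is_derive (0 : R) 1 F l ->
  (forall s, 0 < s -> s < d -> F s - F 0 <= s * M) -> l <= M.
Proof.
move=> d0 [Fd lE] FM.
have /cvg_dnbhs_at_right ql :
    (fun h : R => h^-1 *: ((F \o shift (0 : R)) (h *: (1 : R)) - F 0)) @ 0^' --> l.
  by rewrite -lE.
rewrite leNgt; apply/negP => Ml.
near (0 : R)^'+ => s.
have s0 : 0 < s by [].
have : `|l - s^-1 *: ((F \o shift (0 : R)) (s *: (1 : R)) - F 0)| < l - M.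
  by near: s; move/cvgrPdist_lt : ql; apply; rewrite subr_gt0.
rewrite /= addr0 [s *: 1]mulr1 => /ltr_normlW.
have : s^-1 *: (F s - F 0) <= M.
  by rewrite /GRing.scale/= mulrC ler_pdivrMr// [leRHS]mulrC; apply: FM.
lra.
Unshelve. all: by end_near. Qed.

Lemma u_line0 x h : omega x ->
  is_derive (0 : R) 1 (fun t : R => u (x + t *: h)) (dot (grad u x) h).
Proof.
move=> wx; have := u_line R omega omega_open u uC1 x h 0.
by rewrite scale0r addr0; apply.
Qed.

(** An upper bound for the difference quotients on one side is enough, so this
applies to convex functions as well as at a local maximum. *)
Lemma grad_le x h (M d : R) : omega x -> 0 < d ->
  (forall s : R, 0 < s -> s < d -> u (x + s *: h) <= u x + s * M) ->
  dot (grad u x) h <= M.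
Proof.
move=> wx d0 uM; apply: (is_derive_le _ _ _ _ d0 (u_line0 x h wx)) => s s0 sd.
by rewrite scale0r addr0 lerBlDl; exact: uM.
Qed.

Lemma grad_ge x h (M d : R) : omega x -> 0 < d ->
  (forall s : R, 0 < s -> s < d -> u x + s * M <= u (x + s *: h)) ->
  M <= dot (grad u x) h.
Proof.
move=> wx d0 uM; rewrite -lerN2.
apply: (is_derive_le _ _ _ _ d0 (is_deriveN (u_line0 x h wx))) => s s0 sd.
change (- u (x + s *: h) - - u (x + 0 *: h) <= s * - M).
move: (uM s s0 sd); rewrite scale0r addr0; set a := u _; set b := u _; lra.
Qed.

Definition osquare p (d : R) : set (R * R) :=
  [set q | `|q.1 - p.1| < d /\ `|q.2 - p.2| < d].

Lemma coord_conv (a b c d s : R) : `|a - c| < d -> `|b - c| < d ->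
  0 <= s <= 1 -> `|s * a + (1 - s) * b - c| < d.
Proof.
move=> ac bc /andP[s0 s1].
have -> : s * a + (1 - s) * b - c = s * (a - c) + (1 - s) * (b - c) by ring.
rewrite (le_lt_trans (ler_normD _ _))// !normrM (ger0_norm s0).
rewrite (@ger0_norm _ (1 - s)); last by rewrite subr_ge0.
by have [xy|/ltW xy] := lerP `|a - c| `|b - c|; nra.
Qed.

Lemma osquare_conv p d x y (s : R) : osquare p d x -> osquare p d y ->
  0 <= s <= 1 -> osquare p d (s *: x + (1 - s) *: y).
Proof. by move=> [x1 x2] [y1 y2] s01; split; rewrite !pairE; exact: coord_conv. Qed.

Lemma strictly_convex_lt : strictly_convex_on omega u -> forall x y (t : R),
  x != y -> (forall s : R, 0 <= s <= 1 -> omega (s *: x + (1 - s) *: y)) ->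
  0 < t < 1 -> u (t *: x + (1 - t) *: y) < t * u x + (1 - t) * u y.
Proof.
move=> sc x y t xy seg /andP[t0 t1].
have := sc x y xy _ (Itv01 (ltW t0) (ltW t1)); apply.
  by move=> s; apply: seg; rewrite ge0 le1.
by rewrite /= t0 t1.
Qed.

Hypothesis uS : strictly_convex_on omega u.

(** The slope of the secant from x0 to the midpoint of x0 and x is at least the
derivative, by [grad_le], and strictly less than the slope of the secant from
x0 to x. *)
Lemma above_tangent x0 d x : osquare x0 d `<=` omega -> osquare x0 d x ->
  x != x0 -> dot (grad u x0) (x - x0) < u x - u x0.
Proof.
move=> sw sx xx0.
have s0 : osquare x0 d x0.
  have [h1 _] := sx; have d0 := le_lt_trans (normr_ge0 _) h1.
  by split; rewrite subrr normr0.
have seg (s : R) : 0 <= s <= 1 -> omega (s *: x + (1 - s) *: x0).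
  by move=> s01; apply: sw; exact: osquare_conv.
have lineE (s : R) : s *: x + (1 - s) *: x0 = x0 + s *: (x - x0).
  by rewrite scalerBl scalerBr scale1r addrC -addrA [- _ + _]addrC.
have sl (s : R) : 0 < s < 1 ->
    u (x0 + s *: (x - x0)) < s * u x + (1 - s) * u x0.
  by move=> s01; rewrite -lineE; exact: strictly_convex_lt.
pose m := x0 + 2^-1 *: (x - x0).
have half : 0 < (2^-1 : R) < 1 by apply/andP; split; lra.
have um := sl _ half; rewrite -/m in um.
have mx0 : m != x0.
  rewrite /m -subr_eq0 addrC addKr scaler_eq0 subr_eq0 (negbTE xx0) orbF.
  by apply: lt0r_neq0; lra.
have ml (s : R) : 0 < s -> s < 1 ->
    u (x0 + s *: (m - x0)) <= u x0 + s * (u m - u x0).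
  move=> s0' s1; apply: ltW.
  have -> : u x0 + s * (u m - u x0) = s * u m + (1 - s) * u x0 by ring.
  have -> : x0 + s *: (m - x0) = s *: m + (1 - s) *: x0.
    by rewrite scalerBl scalerBr scale1r [RHS]addrC -[RHS]addrA [- _ + _ in RHS]addrC.
  apply: strictly_convex_lt => //; last by rewrite s0' s1.
  move=> s' /andP[s'0 s'1].
  have -> : s' *: m + (1 - s') *: x0 = (s' / 2) *: x + (1 - s' / 2) *: x0.
    rewrite lineE /m scalerDr scalerA [LHS]addrAC -scalerDl.
    by rewrite addrCA subrr addr0 scale1r.
  by apply: seg; apply/andP; split; lra.
have := grad_le x0 (m - x0) _ 1 (sw _ s0) ltr01 ml.
have -> : dot (grad u x0) (m - x0) = dot (grad u x0) (x - x0) / 2.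
  by rewrite /m addrC addKr /dot !pairE; field.
move: um; set G := dot _ _; set a := u m; lra.
Qed.

Lemma continuous_sqnormB x0 : continuous (fun q : R * R => sqnorm (q - x0)).
Proof.
move=> q; rewrite /sqnorm.
have c1 : {for q, continuous (fun q : R * R => (q - x0).1)}.
  by apply: (@cvgB _ _ _ _ _ (fun q : R * R => q.1)); [exact: cvg_fst|exact: cvg_cst].
have c2 : {for q, continuous (fun q : R * R => (q - x0).2)}.
  by apply: (@cvgB _ _ _ _ _ (fun q : R * R => q.2)); [exact: cvg_snd|exact: cvg_cst].
by apply: cvgD; apply: cvgM.
Qed.

Lemma continuous_dotB g x0 : continuous (fun q : R * R => dot g (q - x0)).
Proof.
move=> q; rewrite /dot.
have c1 : {for q, continuous (fun q : R * R => (q - x0).1)}.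
  by apply: (@cvgB _ _ _ _ _ (fun q : R * R => q.1)); [exact: cvg_fst|exact: cvg_cst].
have c2 : {for q, continuous (fun q : R * R => (q - x0).2)}.
  by apply: (@cvgB _ _ _ _ _ (fun q : R * R => q.2)); [exact: cvg_snd|exact: cvg_cst].
by apply: cvgD; apply: cvgM => //; exact: cvg_cst.
Qed.

(** With l the tangent plane at x0, m > 0 the minimum of u - l outside the disk
inscribed in a square, and K = m / (4 r^2), the function u - l - K |x - x0|^2 is
larger on that part of the square than at x0. Its minimum z over the square is
therefore interior, and u is above a paraboloid of opening K through (z, u z). *)
Lemma exists_touching x0 : omega x0 -> exists z a K, [/\ omega z, 0 < K &
  exists2 d, 0 < d & forall q, osquare z d q ->
    u z + dot a (q - z) + K * sqnorm (q - z) <= u q].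
Proof.
move=> wx0.
have /nbhs_osquareP[d d0 dw] : nbhs x0 omega by exact: open_nbhs_nbhs.
have {}dw : osquare x0 d `<=` omega by move=> q [q1 q2]; exact: dw.
pose r := d / 2.
have r0 : 0 < r by rewrite divr_gt0.
pose S := `[x0.1 - r, x0.1 + r] `*` `[x0.2 - r, x0.2 + r] : set (R * R).
have Scompact : compact S by apply: compact_setX; exact: segment_compact.
have SP q : S q <-> `|q.1 - x0.1| <= r /\ `|q.2 - x0.2| <= r.
  by rewrite /S /= !in_itv/= !ler_distl.
have Sd q : S q -> osquare x0 d q.
  by move=> /SP[q1 q2]; split; rewrite (le_lt_trans q1, le_lt_trans q2)// /r; lra.
pose g := grad u x0.
(* A point of S outside A lies in the open disk inscribed in S, hence inside S. *)
pose A := S `&` [set q | r ^+ 2 <= sqnorm (q - x0)].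
have Acompact : compact A.
  apply: compact_closedI => //.
  apply: (preimage_closed (f := fun q : R * R => sqnorm (q - x0)) _
    (@closed_ge R (r ^+ 2))).
  by move=> q _; exact: continuous_sqnormB.
have A0 : A !=set0.
  exists (x0.1 + r, x0.2); split.
    apply/SP; rewrite /= addrAC subrr add0r subrr normr0.
    by rewrite (ger0_norm (ltW r0)); split; [exact: lexx|exact: ltW].
  rewrite /= /sqnorm !pairE /=.
  have -> : (x0.1 + r - x0.1) ^+ 2 + (x0.2 - x0.2) ^+ 2 = r ^+ 2 by ring.
  exact: lexx.
pose w q := u q - dot g (q - x0).
have wcont q : S q -> {for q, continuous w}.
  by move=> /Sd/dw wq; apply: cvgB; [exact: uC|exact: continuous_dotB].
have [|c cA cmin] := @compact_EVT_min _ R w A A0 Acompact.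
  apply: continuous_in_subspaceT => q; rewrite inE => -[Sq _]; exact: wcont.
pose m := w c - u x0.
have m0 : 0 < m.
  move: cA; rewrite inE => -[Sc /= rc].
  have cx0 : c != x0.
    apply/eqP => cx0; move: rc.
    by rewrite cx0 /sqnorm !pairE !subrr expr0n/= addr0 leNgt exprn_gt0.
  rewrite /m /w subr_gt0 ltrBrDl -ltrBrDr.
  exact: above_tangent (Sd _ Sc) cx0.
(* On the square |x - x0|^2 <= 2 r^2, so the penalty is at most m / 2. *)
pose K := m / (4 * r ^+ 2).
have K0 : 0 < K by rewrite divr_gt0// mulr_gt0// exprn_gt0.
pose wK q := w q - K * sqnorm (q - x0).
have S0 : S x0 by apply/SP; rewrite !subrr normr0; split; exact: ltW.
have [||z zS zmin] := @compact_EVT_min _ R wK S _ Scompact.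
- by exists x0.
- apply: continuous_in_subspaceT => q; rewrite inE => Sq.
  apply: cvgB; first exact: wcont.
  by apply: cvgM; [exact: cvg_cst|exact: continuous_sqnormB].
move: zS; rewrite inE => zS.
have wKx0 : wK x0 = u x0.
  by rewrite /wK /w /dot /sqnorm !pairE !subrr expr0n/= addr0 !mulr0 addr0 !subr0.
have zin : sqnorm (z - x0) < r ^+ 2.
  rewrite ltNge; apply/negP => zr.
  have zA : z \in A by rewrite inE; split.
  have := cmin _ zA; have := zmin x0; rewrite wKx0 inE => /(_ S0).
  have : sqnorm (z - x0) <= 2 * r ^+ 2.
    move/SP : zS => [z1 z2]; rewrite /sqnorm !pairE.
    rewrite -(real_normK (num_real (z.1 - x0.1))).
    rewrite -(real_normK (num_real (z.2 - x0.2))).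
    have n1 : `|z.1 - x0.1| ^+ 2 <= r ^+ 2 by rewrite ler_pXn2r// nnegrE// ltW.
    have n2 : `|z.2 - x0.2| ^+ 2 <= r ^+ 2 by rewrite ler_pXn2r// nnegrE// ltW.
    lra.
  move=> /(ler_wpM2l (ltW K0)).
  have -> : K * (2 * r ^+ 2) = m / 2.
    by rewrite /K; field; rewrite gt_eqF// exprn_gt0.
  rewrite /wK; move: m0; rewrite /m.
  set s := sqnorm _; set Wz := w z; set Wc := w c; set ux := u x0; lra.
have [z1 z2] : `|z.1 - x0.1| < r /\ `|z.2 - x0.2| < r.
  move: zin; rewrite /sqnorm !pairE.
  rewrite -(real_normK (num_real (z.1 - x0.1))).
  rewrite -(real_normK (num_real (z.2 - x0.2))) => zin.
  have n1 := normr_ge0 (z.1 - x0.1); have n2 := normr_ge0 (z.2 - x0.2).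
  by split; rewrite ltNge; apply/negP => rz; nra.
(* The gradient at z of l + K |x - x0|^2. *)
exists z, (g + (2 * K) *: (z - x0)), K; split => //; first exact/dw/Sd.
exists (Num.min (r - `|z.1 - x0.1|) (r - `|z.2 - x0.2|)).
  by rewrite lt_min !subr_gt0 z1 z2.
move=> q [/=]; rewrite !lt_min !ltrBrDr => /andP[q1 _] /andP[_ q2].
have Sq : S q.
  apply/SP; split.
    have -> : q.1 - x0.1 = (q.1 - z.1) + (z.1 - x0.1) by ring.
    by rewrite (le_trans (ler_normD _ _))// ltW.
  have -> : q.2 - x0.2 = (q.2 - z.2) + (z.2 - x0.2) by ring.
  by rewrite (le_trans (ler_normD _ _))// ltW.
have := zmin q; rewrite inE => /(_ Sq).
rewrite -subr_ge0 => h; rewrite -subr_ge0; apply: le_trans h _.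
rewrite le_eqVlt; apply/orP; left; apply/eqP; rewrite /wK /w /dot /sqnorm !pairE; clear; ring.
Qed.

End Touching.

Arguments osquare {R}.

(** * Uniform convexity near a point *)

Section StrongConvexity.
Context (R : realType) (omega : set (R * R)) (omega_open : open omega).
Context (u : R * R -> R).
Hypothesis uC : forall p, omega p -> {for p, continuous u}.
Hypothesis uC1 : C1_on omega u.
Hypothesis uC2 : forall i, C1_on omega ('D_(stdvec R i) u).
Implicit Types (p q v h x y z : R * R).

(** The defect of convexity: the chord minus the function. *)
Definition conv_gap (f : R * R -> R) (t : R) x y :=
  t * f x + (1 - t) * f y - f (t *: x + (1 - t) *: y).

Lemma is_derive_sqr (k s : R) :
  is_derive s 1 (fun s : R => k * s ^+ 2) (2 * k * s).
Proof.
apply: is_derive_of_remainder => e e0.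
exists (e / (1 + `|k|)); first by rewrite divr_gt0// ltr_wpDr.
move=> h; rewrite ltr_pdivlMr ?ltr_wpDr// => he.
have -> : s + h *: 1 = s + h by rewrite [h *: 1]mulr1.
have -> : k * (s + h) ^+ 2 - k * s ^+ 2 - h * (2 * k * s) = k * h * h by ring.
rewrite !normrM ler_wpM2r//; have := normr_ge0 h; have := normr_ge0 k; nra.
Qed.

Lemma hess0 z : hess u z 0 = 0.
Proof. exact: etrans (congr2 +%R (mulr0 _) (mulr0 _)) (addr0 _). Qed.

Lemma dot0v v : dot 0 v = 0.
Proof. by rewrite /dot /= !mul0r addr0. Qed.

#[local] Opaque hess grad.

(** On the segment the function G s = u (y + s (x - y)) - (c / 2) |x - y|^2 s^2 has a
nondecreasing derivative, by the mean value theorem, so its own defect of convexity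
is nonnegative. *)
Lemma hess_conv_gap z (r c t : R) x y : osquare z r `<=` omega -> 0 < c ->
  (forall x h, osquare z r x -> c * sqnorm h <= hess u x h) ->
  osquare z r x -> osquare z r y -> 0 <= t <= 1 ->
  c / 2 * (t * (1 - t)) * sqnorm (x - y) <= conv_gap u t x y.
Proof.
move=> sw c0 hc sx sy /andP[t0 t1].
pose h := x - y.
have lineE (s : R) : s *: x + (1 - s) *: y = y + s *: h.
  by rewrite /h scalerBl scalerBr scale1r addrC -addrA [- _ + _]addrC.
have sq (s : R) : 0 <= s <= 1 -> osquare z r (y + s *: h).
  by move=> s01; rewrite -lineE; exact: osquare_conv.
pose k := c / 2 * sqnorm h.
pose F s := u (y + s *: h).
pose F' s := dot (grad u (y + s *: h)) h.
have dF (s : R) : 0 <= s <= 1 -> is_derive s 1 F (F' s).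
  by move=> s01; apply: (u_line R omega omega_open u uC1); apply/sw/sq.
have dG (s : R) : 0 <= s <= 1 ->
    is_derive s 1 (fun s : R => F s - k * s ^+ 2) (F' s - 2 * k * s).
  move=> s01.
  have dsq := is_derive_sqr k s.
  exact: (is_deriveB (dF _ s01) dsq).
have [xi xib e1] : exists2 c, Num.min t 1 <= c <= Num.max t 1 &
    (F 1 - k * 1 ^+ 2) - (F t - k * t ^+ 2) = (F' c - 2 * k * c) * (1 - t).
  apply: (MVT_between R (fun s => F s - k * s ^+ 2) (fun s => F' s - 2 * k * s)).
  rewrite (min_l t1) (max_r t1) => s /andP[s1 s2].
  by apply: dG; rewrite (le_trans t0 s1).
have [eta etab e2] : exists2 c, Num.min t 0 <= c <= Num.max t 0 &
    (F 0 - k * 0 ^+ 2) - (F t - k * t ^+ 2) = (F' c - 2 * k * c) * (0 - t).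
  apply: (MVT_between R (fun s => F s - k * s ^+ 2) (fun s => F' s - 2 * k * s)).
  rewrite (min_r t0) (max_l t0) => s /andP[s1 s2].
  by apply: dG; rewrite s1 (le_trans s2 t1).
move: xib etab; rewrite (min_l t1) (max_r t1) (min_r t0) (max_l t0).
move=> /andP[xi1 xi2] /andP[eta1 eta2].
have ex : eta <= xi by exact: le_trans xi1.
have [w wb e3] : exists2 c, Num.min eta xi <= c <= Num.max eta xi &
    F' xi - F' eta = hess u (y + c *: h) h * (xi - eta).
  apply: (MVT_between R F' (fun s => hess u (y + s *: h) h)).
  rewrite (min_l ex) (max_r ex) => s /andP[s1 s2].
  apply: (dgrad_line R omega omega_open u uC2); apply/sw/sq.
  by rewrite (le_trans eta1 s1) (le_trans s2 xi2).
move: wb; rewrite (min_l ex) (max_r ex) => /andP[w1 w2].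
have hw : c * sqnorm h <= hess u (y + w *: h) h.
  by apply: hc; apply: sq; rewrite (le_trans eta1 w1) (le_trans w2 xi2).
have mono : 2 * k * (xi - eta) <= F' xi - F' eta.
  by rewrite e3 ler_wpM2r ?subr_ge0// /k mulrA [2 * (c / 2)]mulrC divfK.
have F1 : F 1 = u x by rewrite /F /h scale1r addrC subrK.
have F0 : F 0 = u y by rewrite /F scale0r addr0.
rewrite /conv_gap lineE -F1 -F0 -/(F t) -/h.
have -> : c / 2 * (t * (1 - t)) * sqnorm h = k * (t * (1 - t)) by rewrite /k; ring.
rewrite -subr_ge0.
have -> : t * F 1 + (1 - t) * F 0 - F t - k * (t * (1 - t)) =
  t * (F 1 - k * 1 ^+ 2 - (F t - k * t ^+ 2))
  + (1 - t) * (F 0 - k * 0 ^+ 2 - (F t - k * t ^+ 2)) by ring.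
rewrite e1 e2.
have -> : t * ((F' xi - 2 * k * xi) * (1 - t)) +
    (1 - t) * ((F' eta - 2 * k * eta) * (0 - t)) =
  t * (1 - t) * (F' xi - F' eta - 2 * k * (xi - eta)) by clear; ring.
by rewrite !mulr_ge0 ?subr_ge0.
Qed.

Hypothesis uS : strictly_convex_on omega u.

(** The Hessian is bounded below near the point of [exists_touching]. If the
gradient vanishes there, it does not a little further in the direction of the first
axis, where the first partial derivative is increasing. *)
Lemma exists_strongly_convex_square : omega !=set0 ->
  exists z r c, [/\ 0 < r, 0 < c, osquare z r `<=` omega, grad u z != 0 &
    forall x y t, osquare z r x -> osquare z r y -> 0 <= t <= 1 ->
      c * (t * (1 - t)) * sqnorm (x - y) <= conv_gap u t x y].
Proof.
move=> [x0 wx0].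
have [z [a [K [wz K0 [d d0 touch]]]]] :=
  exists_touching R omega omega_open u uC uC1 uS x0 wx0.
have hz h : K * sqnorm h <= hess u z h.
  have [->|h0] := eqVneq h 0.
    by rewrite hess0 /sqnorm /= expr0n/= addr0 mulr0.
  have [d' d'0 dP] : exists2 d', 0 < d' &
      forall s : R, `|s| < d' -> osquare z d (z + s *: h).
    by apply: nbhs_line; apply/nbhs_osquareP; exists d => // q q1 q2; split.
  apply: (hess_ge_of_touching R omega omega_open u uC1 uC2 z h (dot a h) _ d') => //.
    by rewrite mulr_gt0// sqnorm_gt0.
  move=> s /dP /touch; rewrite [z + _ - z]addrC addKr; congr (is_true (_ <= _)).
  by rewrite /dot /sqnorm !pairE; ring.
have K20 : 0 < K / 2 by rewrite divr_gt0.
have /nbhs_osquareP[r r0 rP] := hess_near R omega omega_open u uC2 z (K / 2) wz K20.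
have rw q : osquare z r q -> omega q by move=> [q1 q2]; have [] := rP _ q1 q2.
have rh q h : osquare z r q -> K / 2 * sqnorm h <= hess u q h.
  move=> [q1 q2]; have [_ /(_ h)] := rP _ q1 q2.
  rewrite ler_norml => /andP[+ _]; have := hz h.
  set A := hess _ _ _; set B := hess _ _ _; set N := sqnorm h; lra.
have r20 : 0 < r / 2 by rewrite divr_gt0.
suff [z' [zsub gz']] : exists z', osquare z' (r / 2) `<=` osquare z r
    /\ grad u z' != 0.
  exists z', (r / 2), (K / 2 / 2); split => //; first by rewrite divr_gt0.
    by move=> q /zsub/rw.
  move=> x y t /zsub sx /zsub sy t01.
  by apply: (hess_conv_gap z r) => //; exact: rh.
have sub z' : `|z'.1 - z.1| <= r / 2 -> `|z'.2 - z.2| <= r / 2 ->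
    osquare z' (r / 2) `<=` osquare z r.
  move=> z1 z2 q [q1 q2]; split.
    have -> : q.1 - z.1 = (q.1 - z'.1) + (z'.1 - z.1) by ring.
    by rewrite (le_lt_trans (ler_normD _ _))//; lra.
  have -> : q.2 - z.2 = (q.2 - z'.2) + (z'.2 - z.2) by ring.
  by rewrite (le_lt_trans (ler_normD _ _))//; lra.
have [gz|gz] := eqVneq (grad u z) 0; last first.
  by exists z; split => //; apply: sub; rewrite subrr normr0 ltW.
pose e : R * R := (1, 0).
exists (z + (r / 2) *: e); split.
  apply: sub; rewrite !pairE /= addrAC subrr add0r.
    by rewrite mulr1 gtr0_norm.
  by rewrite mulr0 normr0 ltW.
have line (s : R) : 0 <= s <= r / 2 -> osquare z r (z + s *: e).
  move=> /andP[s0 s1]; split; rewrite !pairE /= addrAC subrr add0r.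
    by rewrite mulr1 ger0_norm//; lra.
  by rewrite mulr0 normr0.
have [c cb] : exists2 c, Num.min 0 (r / 2) <= c <= Num.max 0 (r / 2) &
    dot (grad u (z + (r / 2) *: e)) e - dot (grad u (z + 0 *: e)) e
    = hess u (z + c *: e) e * (r / 2 - 0).
  apply: (MVT_between R (fun s : R => dot (grad u (z + s *: e)) e)
    (fun s => hess u (z + s *: e) e)).
  rewrite (min_l (ltW r20)) (max_r (ltW r20)) => s sb.
  by apply: (dgrad_line R omega omega_open u uC2); apply/rw/line.
move: cb; rewrite (min_l (ltW r20)) (max_r (ltW r20)) => /line/(rh _ e).
rewrite scale0r addr0 gz dot0v !subr0 => hc E.
apply/eqP => g0; move: E; rewrite g0 dot0v => /esym/eqP.
rewrite mulf_eq0 (gt_eqF r20) orbF => /eqP h0; move: hc; rewrite h0.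
by rewrite /sqnorm /= expr0n/= expr1n addr0 mulr1 leNgt K20.
Qed.

End StrongConvexity.

Arguments conv_gap {R}.

(** * Propagation of uniform convexity *)

Section Gap.
Context (R : realType) (u : R * R -> R).
Hypothesis uConv : convex_function (@Omega R) u.
Implicit Types (p q v h x y z m : R * R).

(** Convexity of the square. *)
Lemma comb_sqr_le (a b t : R) : 0 <= t <= 1 ->
  (t * a + (1 - t) * b) ^+ 2 <= t * a ^+ 2 + (1 - t) * b ^+ 2.
Proof.
move=> /andP[t0 t1]; rewrite -subr_ge0.
have -> : t * a ^+ 2 + (1 - t) * b ^+ 2 - (t * a + (1 - t) * b) ^+ 2
   = t * (1 - t) * (a - b) ^+ 2 by ring.
by apply: mulr_ge0 (sqr_ge0 _); apply: mulr_ge0 => //; rewrite subr_ge0.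
Qed.

Lemma Omega_conv x y (t : R) : Omega x -> Omega y -> 0 <= t <= 1 ->
  Omega (t *: x + (1 - t) *: y).
Proof.
rewrite /Omega /mkset => Ox Oy t01; rewrite !pairE.
have h1 := comb_sqr_le x.1 y.1 t t01; have h2 := comb_sqr_le x.2 y.2 t t01.
by case/andP: t01 => t0 t1; nra.
Qed.

Lemma convex_le x y (t : R) : Omega x -> Omega y -> 0 <= t <= 1 ->
  u (t *: x + (1 - t) *: y) <= t * u x + (1 - t) * u y.
Proof.
move=> Ox Oy /andP[t0 t1].
by have := uConv (Itv01 t0 t1) x y; rewrite !inE; exact.
Qed.

Lemma sqnormZ (a : R) v : sqnorm (a *: v) = a ^+ 2 * sqnorm v.
Proof. by rewrite /sqnorm !pairE; ring. Qed.

Lemma sqnormBC x y : sqnorm (x - y) = sqnorm (y - x).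
Proof. by rewrite /sqnorm !pairE; ring. Qed.

Lemma pair_eq x y : x.1 = y.1 -> x.2 = y.2 -> x = y.
Proof. by case: x y => [a b] [c d] /= -> ->. Qed.

Context (z : R * R) (r c : R).
Hypotheses (r0 : 0 < r) (c0 : 0 < c) (sO : osquare z r `<=` @Omega R).
Hypothesis strong : forall x y t, osquare z r x -> osquare z r y -> 0 <= t <= 1 ->
  c * (t * (1 - t)) * sqnorm (x - y) <= conv_gap u t x y.

Let lam := Num.min 2^-1 (r / 8).

Let lam0 : 0 < lam.
Proof. by rewrite lt_min divr_gt0// invr_gt0 andbT. Qed.

Let lam1 : lam <= 2^-1.
Proof. by rewrite ge_min lexx. Qed.

Let lamr : lam * 2 <= r / 4.
Proof.
have : lam <= r / 8 by rewrite ge_min lexx orbT.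
lra.
Qed.

Let lam01 : 0 <= lam <= 1.
Proof. by rewrite ltW//= (le_trans lam1)//; lra. Qed.

Let r2r : r / 2 < r.
Proof. by rewrite ltr_pdivrMr// mulr_natr mulr2n ltrDl. Qed.

Let osquare_half m : osquare z (r / 2) m -> osquare z r m.
Proof. by move=> [m1 m2]; split; [exact: lt_trans m1 r2r|exact: lt_trans m2 r2r]. Qed.

(** A homothety of ratio [lam] centered near z brings the whole disk into the square
of uniform convexity. *)
Let near_center m x : osquare z (r / 2) m -> Omega x ->
  osquare z r (lam *: x + (1 - lam) *: m).
Proof.
move=> [m1 m2] Ox.
have Om : Omega m by apply: sO; exact: osquare_half.
have [x1 x2] := Omega_coord _ _ Ox; have [n1 n2] := Omega_coord _ _ Om.
have aux (a b d : R) : `|a| <= 1 -> `|b| <= 1 -> `|b - d| < r / 2 ->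
    `|lam * a + (1 - lam) * b - d| < r.
  move=> a1 b1 bd.
  have -> : lam * a + (1 - lam) * b - d = lam * (a - b) + (b - d) by ring.
  rewrite (le_lt_trans (ler_normD _ _))// normrM gtr0_norm//.
  have ab : `|a - b| <= 2 by rewrite (le_trans (ler_normB _ _))//; lra.
  have := ler_wpM2l (ltW lam0) ab; have := lamr; have := r0; lra.
by split; rewrite !pairE; exact: aux.
Qed.

(** Shrink the segment by the factor [lam] around its point m. By convexity of u the
defect at m of the small segment is at most [lam] times that of the large one. *)
Let gap_mid x y (t : R) : Omega x -> Omega y -> 0 <= t <= 1 ->
  osquare z (r / 2) (t *: x + (1 - t) *: y) ->
  c * lam ^+ 2 / 4 * (t * (1 - t)) * sqnorm (x - y) <= conv_gap u t x y.
Proof.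
move=> Ox Oy t01; set m := _ + _ => Km.
have Om : Omega m by exact: Omega_conv.
have sx := near_center _ _ Km Ox; have sy := near_center _ _ Km Oy.
have := strong _ _ _ sx sy t01.
have -> : lam *: x + (1 - lam) *: m - (lam *: y + (1 - lam) *: m) = lam *: (x - y).
  by rewrite opprD addrACA subrr addr0 scalerBr.
rewrite sqnormZ /conv_gap.
have -> : t *: (lam *: x + (1 - lam) *: m) + (1 - t) *: (lam *: y + (1 - lam) *: m) = m.
  by apply: pair_eq; rewrite /m !pairE; ring.
have ux := convex_le _ _ _ Ox Om lam01; have uy := convex_le _ _ _ Oy Om lam01.
move: ux uy; rewrite -/m.
set a := u (lam *: x + _); set b := u (lam *: y + _).
set um := u m; set ux := u x; set uy := u y; set N := sqnorm _ => ha hb main.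
case/andP: t01 => t0 t1.
have ta := ler_wpM2l t0 ha.
have t1' : 0 <= 1 - t by lra.
have tb := ler_wpM2l t1' hb.
have le1 : c * (t * (1 - t)) * (lam ^+ 2 * N) <= lam * (t * ux + (1 - t) * uy - um).
  lra.
have le2 : c * lam * (t * (1 - t)) * N <= t * ux + (1 - t) * uy - um.
  by rewrite -(ler_pM2l lam0); apply: le_trans le1; rewrite le_eqVlt; apply/orP; left;
    apply/eqP; ring.
apply: le_trans le2.
have X0 : 0 <= c * lam * (t * (1 - t)) * N.
  apply: mulr_ge0 (sqnorm_ge0 _ _); rewrite mulr_ge0//; last exact: mulr_ge0.
  by rewrite ltW// mulr_gt0.
have -> : c * lam ^+ 2 / 4 * (t * (1 - t)) * N =
   lam / 4 * (c * lam * (t * (1 - t)) * N) by field.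
by rewrite ler_piMl//; have := lam1; lra.
Qed.

(** Shrinking around the endpoint x bounds the defect from below at the single
parameter [lam] / 2. As a function of the parameter the defect is concave and vanishes
at both ends, which bounds it everywhere. *)
Let gap_left x y (s : R) : Omega x -> Omega y -> 0 <= s <= 1 ->
  osquare z (r / 2) x ->
  c * lam ^+ 2 / 4 * (s * (1 - s)) * sqnorm (y - x) <= conv_gap u s y x.
Proof.
move=> Ox Oy /andP[s0 s1] Kx.
have sx := osquare_half _ Kx.
have sy := near_center _ _ Kx Oy.
set y' := lam *: y + _ in sy.
have half : 0 <= (2^-1 : R) <= 1 by apply/andP; split; lra.
have := strong _ _ _ sy sx half.
pose sg := lam / 2.
have sg01 : 0 < sg <= 4^-1 by rewrite /sg; have := lam0; have := lam1; move=> *; apply/andP; split; lra.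
case/andP: sg01 => sg0 sg1.
pose m := sg *: y + (1 - sg) *: x.
have -> : y' - x = lam *: (y - x).
  by apply: pair_eq; rewrite /y' !pairE; ring.
rewrite sqnormZ /conv_gap.
have -> : 2^-1 *: y' + (1 - 2^-1) *: x = m.
  by apply: pair_eq; rewrite /m /y' /sg !pairE; field.
have Om : Omega m by apply: Omega_conv => //; apply/andP; split; lra.
have uy' := convex_le _ _ _ Oy Ox lam01; rewrite -/y' in uy'.
have N0 := sqnorm_ge0 _ (y - x).
move: uy'; set N := sqnorm _ in N0 *; set a := u y' => uy' main.
have Esg : c * lam ^+ 2 / 4 * N <= sg * u y + (1 - sg) * u x - u m.
  move: uy' main; rewrite /sg; set um := u m; set ux := u x; set uy := u y; lra.
set kap := c * lam ^+ 2 / 4 in Esg *.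
have k0 : 0 <= kap * N.
  by apply: mulr_ge0 N0; rewrite ltW// divr_gt0// mulr_gt0// exprn_gt0.
have [ssg|/ltW ssg] := lerP s sg.
  have w01 : 0 <= s / sg <= 1.
    by rewrite divr_ge0 ?(ltW sg0)//= ler_pdivrMr// mul1r.
  have := convex_le _ _ _ Om Ox w01.
  have -> : (s / sg) *: m + (1 - s / sg) *: x = s *: y + (1 - s) *: x.
    by apply: pair_eq; rewrite /m !pairE; field; rewrite gt_eqF.
  set v := u (s *: y + _); set w := s / sg in w01 *.
  have sE : s = w * sg by rewrite /w divfK ?gt_eqF.
  move=> vle; case/andP: w01 => w0 w1.
  have := ler_wpM2l w0 Esg.
  have : s * (1 - s) * (kap * N) <= w * (kap * N).
    apply: ler_wpM2r => //; rewrite sE; nra.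
  have -> : w * (sg * u y + (1 - sg) * u x - u m) =
      s * u y + (w - s) * u x - w * u m by rewrite [in RHS]sE; ring.
  move: vle; set um := u m; set ux := u x; set uy := u y.
  have -> : kap * (s * (1 - s)) * N = s * (1 - s) * (kap * N) by ring.
  set kN := kap * N; lra.
have sg1' : 0 < 1 - sg by lra.
have w01 : 0 <= (1 - s) / (1 - sg) <= 1.
  by rewrite divr_ge0 ?subr_ge0 ?(ltW sg1')//=; [rewrite ler_pdivrMr// mul1r; lra|lra].
have := convex_le _ _ _ Om Oy w01.
set w := _ / (1 - sg) in w01 *.
have sE : s = 1 - w * (1 - sg) by rewrite /w divfK ?gt_eqF//; ring.
have -> : w *: m + (1 - w) *: y = s *: y + (1 - s) *: x.
  by apply: pair_eq; rewrite sE /m !pairE; ring.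
set v := u (s *: y + _) => vle; case/andP: w01 => w0 w1.
have := ler_wpM2l w0 Esg.
have : s * (1 - s) * (kap * N) <= w * (kap * N).
  apply: ler_wpM2r => //; rewrite {2}sE; nra.
have -> : w * (sg * u y + (1 - sg) * u x - u m) =
    (w + s - 1) * u y + (1 - s) * u x - w * u m by rewrite [in RHS]sE; ring.
move: vle; set um := u m; set ux := u x; set uy := u y.
have -> : kap * (s * (1 - s)) * N = s * (1 - s) * (kap * N) by ring.
set kN := kap * N; lra.
Qed.

Lemma exists_conv_gap_ge : exists2 c', 0 < c' & forall x y (t : R),
  Omega x -> Omega y -> 0 <= t <= 1 ->
  (osquare z (r / 2) x \/ osquare z (r / 2) y
   \/ osquare z (r / 2) (t *: x + (1 - t) *: y)) ->
  c' * (t * (1 - t)) * sqnorm (x - y) <= conv_gap u t x y.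
Proof.
exists (c * lam ^+ 2 / 4); first by rewrite divr_gt0// mulr_gt0// exprn_gt0.
move=> x y t Ox Oy t01 [Kx|[Ky|Km]]; last exact: gap_mid.
  have t01' : 0 <= 1 - t <= 1 by case/andP: t01 => *; apply/andP; split; lra.
  have := gap_left x y (1 - t) Ox Oy t01' Kx.
  rewrite sqnormBC /conv_gap; have -> : 1 - (1 - t) = t by ring.
  by rewrite [(1 - t) * t]mulrC [(1 - t) *: y + _]addrC [(1 - t) * u y + _]addrC.
exact: gap_left.
Qed.

End Gap.

(** * Admissible perturbations *)

Section Perturbation.
Context (R : realType).
Implicit Types (p q v h x y z m : R * R) (f phi u : R * R -> R).

(** The two Taylor formulas at m = t x + (1 - t) y have linear parts
(1 - t) D and - t D, which cancel in the combination with weights t and 1 - t. *)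
Lemma C11_conv_gap f g (C : R) x y (t : R) : C11 f g C -> Omega x -> Omega y ->
  0 <= t <= 1 -> `|conv_gap f t x y| <= C * (t * (1 - t)) * sqnorm (x - y).
Proof.
move=> fC Ox Oy t01; rewrite /conv_gap; set m := t *: x + _.
have Om : Omega m by exact: Omega_conv.
have [_ _ _] := fC _ _ Om Ox; have [_ _ _] := fC _ _ Om Oy.
have -> : x - m = (1 - t) *: (x - y).
  by apply: pair_eq; rewrite /m !pairE; ring.
have -> : y - m = (- t) *: (x - y).
  by apply: pair_eq; rewrite /m !pairE; ring.
rewrite !sqnormZ.
have dZ (a : R) v w : dot v (a *: w) = a * dot v w.
  by rewrite /dot !pairE; ring.
rewrite !dZ; set D := dot _ _; set N := sqnorm _ => hy hx.
have -> : t * f x + (1 - t) * f y - f m =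
  t * (f x - f m - (1 - t) * D) + (1 - t) * (f y - f m - - t * D) by ring.
case/andP: t01 => t0 t1; have t1' : 0 <= 1 - t by lra.
rewrite (le_trans (ler_normD _ _))// !normrM (ger0_norm t0) (ger0_norm t1').
have := ler_wpM2l t0 hx; have := ler_wpM2l t1' hy.
set X := `|f x - _ - _|; set Y := `|f y - _ - _| => h1 h2.
have -> : C * (t * (1 - t)) * N =
  t * (C * ((1 - t) ^+ 2 * N)) + (1 - t) * (C * ((- t) ^+ 2 * N)) by ring.
lra.
Qed.

Lemma C11_lower_semicontinuousD u phi g (C tau : R) :
  C11 phi g C ->
  lower_semicontinuous ((fun p => (u p)%:E) : subspace (@Omega R) -> \bar R) ->
  lower_semicontinuous
    ((fun p => (u p + tau * phi p)%:E) : subspace (@Omega R) -> \bar R).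
Proof.
move=> phiC ulsc x a; rewrite lte_fin => ax.
have [Ox|nOx] := pselect (Omega x); last first.
  exists [set x]; last by move=> y ->; rewrite lte_fin.
  have -> : @nbhs _ (subspace (@Omega R)) x = globally [set x].
    by symmetry; have := @nbhs_subspace_out _ (@Omega R) x nOx; exact.
  by [].
have nO : @nbhs _ (subspace (@Omega R)) x = within (@Omega R) (nbhs (x : R * R)).
  by symmetry; have := @nbhs_subspace_in _ (@Omega R) x Ox; exact.
pose e := (u x + tau * phi x - a) / 2.
have e0 : 0 < e by rewrite divr_gt0// subr_gt0.
have [|V1 nV1 hV1] := ulsc x (u x - e); first by rewrite lte_fin ltrBlDr ltrDl.
have [phix _ _ _] := phiC _ _ Ox Ox.
have C0 : 0 <= C by exact: le_trans phix.
pose L := 1 + `|tau| * (3 * C).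
have L0 : 0 < L by rewrite ltr_wpDr// !mulr_ge0.
exists (V1 `&` [set y | Omega y -> `|tau * phi y - tau * phi x| < e] `&` @Omega R).
  apply: filterI; last first.
    by rewrite nO; exact: withinT.
  apply: filterI => //; rewrite nO; apply: (@cvg_within _ (nbhs (x : R * R))).
  apply/nbhs_osquareP; exists (e / (2 * L)).
    by rewrite divr_gt0// mulr_gt0.
  move=> y; rewrite !ltr_pdivlMr ?mulr_gt0// => y1 y2 Oy.
  rewrite -mulrBr normrM.
  have := C11_lip R _ _ _ _ _ phiC Ox Oy.
  move=> /(ler_wpM2l (normr_ge0 tau)) /le_lt_trans; apply.
  move: y1 y2; rewrite /L; set Y1 := `|y.1 - _|; set Y2 := `|y.2 - _| => y1 y2.
  have Y10 : 0 <= Y1 by exact: normr_ge0.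
  have Y20 : 0 <= Y2 by exact: normr_ge0.
  have T0 : 0 <= `|tau| * (3 * C) by rewrite !mulr_ge0.
  move: y1 y2 T0; set T := `|tau| * (3 * C) => y1 y2 T0.
  have -> : `|tau| * (3 * C * (Y1 + Y2)) = T * (Y1 + Y2) by rewrite /T; ring.
  rewrite /e ltr_pdivlMr//; nra.
move=> y [[yV1 yV2] Oy]; rewrite lte_fin.
have := hV1 _ yV1; have := yV2 Oy; rewrite lte_fin ltr_norml => /andP[+ _].
rewrite /e; clear; set ty := tau * phi y; set tx := tau * phi x; lra.
Qed.

(** When neither the endpoints nor the point of division lie in K, phi contributes
nothing to the defect of convexity; otherwise its contribution is dominated by the
defect of u. *)
Lemma perturb_Chat u phi g (C tau c del : R) (K : set (R * R)) :
  Chat u -> C11 phi g C -> K `<=` @Omega R ->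
  (forall p, ~ K p -> phi p = 0) ->
  (forall p, K p -> -1 + del <= u p <= - del) ->
  (forall x y (t : R), Omega x -> Omega y -> 0 <= t <= 1 ->
    (K x \/ K y \/ K (t *: x + (1 - t) *: y)) ->
    c * (t * (1 - t)) * sqnorm (x - y) <= conv_gap u t x y) ->
  `|tau| * C <= c -> `|tau| * C <= del ->
  Chat (fun p => u p + tau * phi p).
Proof.
move=> [urange uConv ulsc] phiC KO phi0 uK ugap tc td; split.
- move=> p Op; have [Kp|nKp] := pselect (K p); last first.
    by rewrite phi0// mulr0 addr0; exact: urange.
  have [phip _ _ _] := phiC _ _ Op Op.
  have : `|tau * phi p| <= del.
    by rewrite normrM; apply: le_trans td; exact: ler_wpM2l.
  rewrite ler_norml => /andP[h1 h2]; have /andP[h3 h4] := uK _ Kp.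
  by move: h1 h2 h3 h4; set a := u p; set b := tau * _ => *; apply/andP; split; lra.
- move=> t x y; rewrite !inE => Ox Oy.
  have t01 : 0 <= t%:num <= 1 by rewrite ge0 le1.
  change (u (t%:num *: x + (1 - t%:num) *: y)
    + tau * phi (t%:num *: x + (1 - t%:num) *: y)
    <= t%:num * (u x + tau * phi x) + (1 - t%:num) * (u y + tau * phi y)).
  move: (t%:num) t01 => {}t t01.
  set m := t *: x + _.
  rewrite -subr_ge0.
  have -> : t * (u x + tau * phi x) + (1 - t) * (u y + tau * phi y)
      - (u m + tau * phi m) = conv_gap u t x y + tau * conv_gap phi t x y.
    by rewrite /conv_gap -/m; ring.
  have [inK|notK] := pselect (K x \/ K y \/ K m).
    have g1 := ugap _ _ _ Ox Oy t01 inK.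
    have g2 := C11_conv_gap _ _ _ _ _ _ phiC Ox Oy t01.
    have g3 : `|tau * conv_gap phi t x y| <= c * (t * (1 - t)) * sqnorm (x - y).
      rewrite normrM (le_trans (ler_wpM2l (normr_ge0 _) g2))//.
      have -> : `|tau| * (C * (t * (1 - t)) * sqnorm (x - y)) =
        `|tau| * C * (t * (1 - t) * sqnorm (x - y)) by ring.
      have -> : c * (t * (1 - t)) * sqnorm (x - y) =
        c * (t * (1 - t) * sqnorm (x - y)) by ring.
      apply: ler_wpM2r tc; apply: mulr_ge0 (sqnorm_ge0 _ _).
      by case/andP: t01 => t0 t1; rewrite mulr_ge0 ?subr_ge0.
    move: g3; rewrite ler_norml => /andP[g3 _].
    move: g1 g3; set A := conv_gap _ _ _ _; set B := tau * _; set D := c * _ * _; lra.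
  have phx : phi x = 0 by apply: phi0 => Kx; apply: notK; left.
  have phy : phi y = 0 by apply: phi0 => Kx; apply: notK; right; left.
  have phm : phi m = 0 by apply: phi0 => Kx; apply: notK; right; right.
  rewrite {2}/conv_gap -/m phx phy phm !mulr0 addr0 subrr mulr0 addr0 subr_ge0.
  exact: convex_le.
- exact: C11_lower_semicontinuousD phiC ulsc.
Qed.

End Perturbation.

(** * The integrand in four oscillating directions *)

Section FourDirections.
Context (R : realType).
Implicit Types (G e w h : R * R).

Lemma sqnormDZ G h (t : R) :
  sqnorm (G + t *: h) = sqnorm G + 2 * (t * dot G h) + t ^+ 2 * sqnorm h.
Proof. by rewrite /sqnorm /dot !pairE; ring. Qed.

(** Half of |G|^6 times the second derivative of t |-> |G + t h|^-2 at 0. *)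
Definition qform G h := 4 * dot G h ^+ 2 - sqnorm h * sqnorm G.

Lemma inv_sqnorm_pm_le G h (t P0 M : R) : 0 < P0 -> P0 / 2 <= sqnorm G ->
  sqnorm h <= M -> 8 * (t ^+ 2 * M) <= P0 / 2 ->
  50 * (t ^+ 2 * M ^+ 2) <= P0 ^+ 3 / 8 ->
  [/\ 0 < sqnorm (G + t *: h), 0 < sqnorm (G + (- t) *: h) &
   (sqnorm (G + t *: h))^-1 + (sqnorm (G + (- t) *: h))^-1
   <= 2 / sqnorm G + t ^+ 2 * (2 * qform G h / sqnorm G ^+ 3 + 2^-1)].
Proof.
move=> P00 PG hM t1 t2.
have H0 := sqnorm_ge0 _ h.
have P0' : 0 < sqnorm G by apply: lt_le_trans PG; rewrite divr_gt0.
have tau0 := sqr_ge0 t.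
have c1 : 8 * (t ^+ 2 * sqnorm h) <= sqnorm G.
  apply: le_trans PG; apply: le_trans t1.
  by rewrite ler_wpM2l// ler_wpM2l.
have c2 : 50 * (t ^+ 2 * sqnorm h ^+ 2) <= sqnorm G ^+ 3.
  apply: (@le_trans _ _ ((P0 / 2) ^+ 3)); last first.
    by rewrite ler_pXn2r// nnegrE ltW// divr_gt0.
  have -> : (P0 / 2) ^+ 3 = P0 ^+ 3 / 8 by field.
  apply: le_trans t2; rewrite ler_wpM2l// ler_wpM2l//.
  by rewrite ler_pXn2r// nnegrE// (le_trans H0).
have := inv_second_difference_le R _ _ _ t P0' H0 (dot_sqr_le _ G h) c1 c2.
rewrite !sqnormDZ sqrrN.
have -> : 2 * (- t * dot G h) = - (2 * (t * dot G h)) by ring.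
by [].
Qed.

(** The gradients of eta sin and eta cos are the two halves of a rotation of
(eta a, w); a quadratic form summed over them loses its cross terms. *)
Lemma qform_oscillation G a w (eta sn cs : R) : sn ^+ 2 + cs ^+ 2 = 1 ->
  qform G (eta *: (cs *: a) + sn *: w) + qform G (eta *: ((- sn) *: a) + cs *: w)
  = eta ^+ 2 * qform G a + qform G w.
Proof.
move=> sc.
have -> : cs ^+ 2 = 1 - sn ^+ 2 -> qform G (eta *: (cs *: a) + sn *: w)
    + qform G (eta *: ((- sn) *: a) + cs *: w)
  = eta ^+ 2 * qform G a * (sn ^+ 2 + cs ^+ 2)
    + qform G w * (sn ^+ 2 + cs ^+ 2).
  by move=> _; rewrite /qform /sqnorm /dot !pairE; ring.
  by rewrite sc !mulr1.
by rewrite -sc addrC addKr.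
Qed.

Lemma four_directions_le G e w (N eta sn cs t P0 Gb M : R)
  (a := N *: e)
  (h1 := eta *: (cs *: a) + sn *: w) (h2 := eta *: ((- sn) *: a) + cs *: w) :
  0 < P0 -> sqnorm e = P0 -> P0 / 2 <= sqnorm G -> sqnorm G <= 2 * P0 ->
  qform G e <= - P0 ^+ 2 / 2 -> sn ^+ 2 + cs ^+ 2 = 1 -> sqnorm w <= Gb ->
  sqnorm h1 <= M -> sqnorm h2 <= M -> 8 * (t ^+ 2 * M) <= P0 / 2 ->
  50 * (t ^+ 2 * M ^+ 2) <= P0 ^+ 3 / 8 ->
  [/\ 0 < sqnorm (G + t *: h1), 0 < sqnorm (G + (- t) *: h1),
      0 < sqnorm (G + t *: h2), 0 < sqnorm (G + (- t) *: h2) &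
   (sqnorm (G + t *: h1))^-1 + (sqnorm (G + (- t) *: h1))^-1 +
   ((sqnorm (G + t *: h2))^-1 + (sqnorm (G + (- t) *: h2))^-1)
   + t ^+ 2 * (N ^+ 2 * eta ^+ 2 / (8 * P0))
   <= 4 / sqnorm G + t ^+ 2 * (24 * Gb / P0 ^+ 2 + 1)].
Proof.
move=> P00 eP PG GP qe sc wG h1M h2M t1 t2.
have [p1 p2 le1] := inv_sqnorm_pm_le _ _ _ _ _ P00 PG h1M t1 t2.
have [p3 p4 le2] := inv_sqnorm_pm_le _ _ _ _ _ P00 PG h2M t1 t2.
split => //; apply: le_trans (lerD (lerD le1 le2) (lexx _)) _.
set P := sqnorm G in PG GP *.
have P0' : 0 < P by apply: lt_le_trans PG; rewrite divr_gt0.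
have -> : 2 / P + t ^+ 2 * (2 * qform G h1 / P ^+ 3 + 2^-1) +
    (2 / P + t ^+ 2 * (2 * qform G h2 / P ^+ 3 + 2^-1)) +
    t ^+ 2 * (N ^+ 2 * eta ^+ 2 / (8 * P0)) =
  4 / P + t ^+ 2 * (2 * (qform G h1 + qform G h2) / P ^+ 3 + 1
     + N ^+ 2 * eta ^+ 2 / (8 * P0)).
  by field; rewrite !gt_eqF.
rewrite lerD2l ler_wpM2l ?sqr_ge0// /h1 /h2 qform_oscillation//.
have -> : qform G a = N ^+ 2 * qform G e.
  by rewrite /a /qform /sqnorm /dot !pairE; ring.
have qw : qform G w <= 3 * (P * Gb).
  have := dot_sqr_le _ G w; rewrite -/P => dw.
  have := ler_wpM2l (ltW P0') wG.
  rewrite /qform -/P; set x := dot _ _ in dw *; set y := sqnorm w in dw *.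
  lra.
have Gb0 : 0 <= Gb by exact: le_trans (sqnorm_ge0 _ w) wG.
have P30 : 0 < P ^+ 3 by rewrite exprn_gt0.
set X := N ^+ 2 * eta ^+ 2.
have X0 : 0 <= X by rewrite mulr_ge0 ?sqr_ge0.
have s1 : 2 * (3 * (P * Gb)) / P ^+ 3 <= 24 * Gb / P0 ^+ 2.
  have -> : 2 * (3 * (P * Gb)) / P ^+ 3 = 6 * Gb / P ^+ 2.
    by field; rewrite gt_eqF.
  rewrite ler_pdivrMr ?exprn_gt0// mulrAC ler_pdivlMr ?exprn_gt0//.
  have -> : 24 * Gb * P ^+ 2 = 6 * Gb * (2 * P) ^+ 2 by ring.
  have g6 : 0 <= 6 * Gb by rewrite mulr_ge0.
  have twoP : 0 <= 2 * P by rewrite mulr_ge0// ltW.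
  have p0P : P0 <= 2 * P by rewrite mulrC -ler_pdivrMr.
  by rewrite ler_wpM2l// ler_pXn2r// nnegrE ltW.
have s2 : X * (2 * qform G e) / P ^+ 3 <= - (X / (8 * P0)).
  have q2 : X * (2 * qform G e) <= - (X * P0 ^+ 2).
    by rewrite -mulrN ler_wpM2l// mulrC -ler_pdivlMr.
  have y : P ^+ 3 / (8 * P0) <= P0 ^+ 2.
    rewrite ler_pdivrMr ?mulr_gt0//.
    have -> : P0 ^+ 2 * (8 * P0) = (2 * P0) ^+ 3 by ring.
    by rewrite ler_pXn2r// nnegrE ltW// mulr_gt0.
  rewrite ler_pdivrMr// (le_trans q2)// mulNr lerN2.
  have -> : X / (8 * P0) * P ^+ 3 = X * (P ^+ 3 / (8 * P0)) by ring.
  exact: ler_wpM2l.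
have s3 : 2 * qform G w / P ^+ 3 <= 2 * (3 * (P * Gb)) / P ^+ 3.
  by rewrite ler_pM2r ?invr_gt0// ler_pM2l.
have -> : 2 * (eta ^+ 2 * (N ^+ 2 * qform G e) + qform G w) / P ^+ 3 =
  X * (2 * qform G e) / P ^+ 3 + 2 * qform G w / P ^+ 3.
  by rewrite /X; field; rewrite gt_eqF.
move: s1 s2 s3; set A1 := _ / _; set A2 := _ / P0 ^+ 2; set A3 := _ / _.
set A4 := X / _; set A5 := _ / _; lra.
Qed.

(** Near G0, the vector orthogonal to G0 is nearly orthogonal to G. *)
Lemma qform_rot_le G G0 (P0 := sqnorm G0) (k : R) : 0 < P0 ->
  k <= 1 -> 128 * k <= P0 ->
  `|G.1 - G0.1| < k -> `|G.2 - G0.2| < k ->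
  [/\ P0 / 2 <= sqnorm G, sqnorm G <= 2 * P0 &
      qform G (- G0.2, G0.1) <= - P0 ^+ 2 / 2].
Proof.
move=> P00 k1 k2 d1 d2.
pose d := G - G0.
have dd : sqnorm d <= P0 / 64.
  have k0 : 0 <= k by rewrite ltW// (le_lt_trans _ d1).
  have kk : k ^+ 2 <= k by rewrite expr2 ler_piMl.
  have n1 : d.1 ^+ 2 <= k ^+ 2.
    by rewrite -(real_normK (num_real d.1)) ler_pXn2r ?nnegrE// ltW.
  have n2 : d.2 ^+ 2 <= k ^+ 2.
    by rewrite -(real_normK (num_real d.2)) ler_pXn2r ?nnegrE// ltW.
  rewrite /sqnorm; lra.
have d0 := sqnorm_ge0 _ d.
have Gd : sqnorm G = P0 + 2 * dot G0 d + sqnorm d.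
  by rewrite /P0 /sqnorm /dot /d !pairE; ring.
have G0d : `|dot G0 d| <= P0 / 8.
  have P8 : 0 <= P0 / 8 by rewrite divr_ge0// ltW.
  rewrite -(ler_pXn2r (n := 2)) ?nnegrE// real_normK ?num_real//.
  apply: le_trans (dot_sqr_le _ G0 d) _; rewrite -/P0.
  have -> : (P0 / 8) ^+ 2 = P0 * (P0 / 64) by field.
  by rewrite ler_wpM2l// ltW.
move: G0d; rewrite ler_norml => /andP[g1 g2].
have GP : P0 * (2 / 3) <= sqnorm G by rewrite Gd; lra.
split; [lra|rewrite Gd; lra|].
have e : dot G (- G0.2, G0.1) ^+ 2 <= P0 * (P0 / 64).
  have -> : dot G (- G0.2, G0.1) = dot (- G0.2, G0.1) d.
    by rewrite /dot /d !pairE /=; ring.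
  apply: le_trans (dot_sqr_le _ _ d) _.
  have -> : sqnorm (- G0.2, G0.1) = P0 by rewrite /P0 /sqnorm /=; ring.
  by rewrite ler_wpM2l// ltW.
rewrite /qform.
have -> : sqnorm (- G0.2, G0.1) = P0 by rewrite /P0 /sqnorm /=; ring.
have := sqr_ge0 P0; have := ler_wpM2l (ltW P00) GP.
move: e; set x := dot _ _; set y := sqnorm G; clear.
move: P0 => Q; lra.
Qed.

End FourDirections.

Arguments qform {R}.

(** * The functional *)

Section Functional.
Context (R : realType).
Implicit Types (p q z : R * R) (u phi : R * R -> R).
Local Notation mu2 := (@lebesgue_measure R \x @lebesgue_measure R)%E.

Definition csquare z (b : R) : set (R * R) :=
  `[z.1 - b, z.1 + b] `*` `[z.2 - b, z.2 + b].

Lemma csquareP z b q :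
  csquare z b q <-> `|q.1 - z.1| <= b /\ `|q.2 - z.2| <= b.
Proof. by rewrite /csquare /= !in_itv/= !ler_distl. Qed.

Lemma measurable_csquare z b : measurable (csquare z b).
Proof. by apply: measurableX; exact: measurable_itv. Qed.

Lemma measure_csquare z (b : R) : 0 < b -> mu2 (csquare z b) = (4 * b ^+ 2)%:E.
Proof.
move=> b0.
have L (c : R) : lebesgue_measure (`[c - b, c + b]%classic : set R) = (2 * b)%:E.
  rewrite lebesgue_measure_itv /= lte_fin ifT.
    by rewrite -EFinB; congr EFin; ring.
  by rewrite ltrD2l gtrN.
rewrite product_measure1E; [|exact: measurable_itv..].
apply: etrans (congr2 mule (L _) (L _)) _.
by rewrite -EFinM; congr EFin; ring.
Qed.

Definition integrand u p : \bar R :=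
  if grad u p == 0 then +oo%E else ((sqnorm (grad u p))^-1)%:E.

Lemma integrand_ge0 u p : (0 <= integrand u p)%E.
Proof.
by rewrite /integrand; case: ifP => // _; rewrite lee_fin invr_ge0 sqnorm_ge0.
Qed.

Lemma integrandE u p : 0 < sqnorm (grad u p) ->
  integrand u p = ((sqnorm (grad u p))^-1)%:E.
Proof.
rewrite /integrand; case: eqP => // ->.
by rewrite /sqnorm /= expr0n/= addr0 ltxx.
Qed.

Lemma JinftyE u : Jinfty u = (\int[mu2]_p (integrand u \_ (@Omega R)) p)%E.
Proof. exact: integral_mkcond. Qed.

Lemma restrict_ge0 u p : (0 <= (integrand u \_ (@Omega R)) p)%E.
Proof. by rewrite /patch; case: ifP => // _; exact: integrand_ge0. Qed.

(** An admissible affine function of nonzero gradient. *)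
Definition tilt p : R := - 2^-1 + 2^-1 * p.1.

Lemma fst_C11 : exists C, C11 (fun p => p.1) (fun=> (1, 0)) C.
Proof.
have d1 p : Omega p -> `|dot (1, 0) p| <= 1.
  by move=> /Omega_coord[? _]; rewrite /dot/= mul1r mul0r addr0.
have h := C11_ridge R id (fun=> 1) (1, 0) 1 1 d1.
exists (1 * (1 + sqnorm ((1 : R), (0 : R)))).
move: h; have -> : (fun p => id (dot (1, 0) p)) = fst.
  by apply/funext => p; rewrite /dot/= mul1r mul0r addr0.
rewrite scale1r; apply => s t s1 t1; split; rewrite ?normr1//.
by rewrite mul1r subrr normr0 mul1r sqr_ge0.
Qed.

Lemma tilt_Chat : Chat tilt.
Proof.
split.
- move=> p /Omega_coord[p1 _]; move: p1; rewrite ler_norml /tilt => /andP[p1 p1'].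
  by apply/andP; split; lra.
- move=> t x y _ _.
  change (tilt (t%:num *: x + (1 - t%:num) *: y)
     <= t%:num * tilt x + (1 - t%:num) * tilt y).
  rewrite /tilt !pairE le_eqVlt; apply/orP; left; apply/eqP; ring.
- have [C hC] := fst_C11.
  apply: (C11_lower_semicontinuousD R (fun=> - 2^-1) _ _ C _ hC).
  by move=> x a ax; exists setT => //; exact: filterT.
Qed.

Lemma tilt_grad p : (grad tilt p).1 = 2^-1.
Proof.
have : is_derive p (stdvec R ord0) tilt 2^-1.
  apply: is_derive_of_remainder => e e0; exists 1 => // h _.
  rewrite /tilt !pairE /=.
  have -> : - 2^-1 + 2^-1 * (p.1 + h * 1) - (- 2^-1 + 2^-1 * p.1) - h * 2^-1 = 0
    by ring.
  by rewrite normr0 mulr_ge0// ltW.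
by case=> _ <-.
Qed.

Lemma Jinfty_tilt_lty : (Jinfty tilt < +oo)%E.
Proof.
rewrite JinftyE.
apply: (@le_lt_trans _ _ (\int[mu2]_p (4 * \1_(csquare 0 1) p)%:E)%E).
  apply: ge0_le_lower_integral; first exact: restrict_ge0.
  move=> p; rewrite /patch; case: ifPn => [|_]; last by rewrite lee_fin mulr_ge0.
  rewrite inE => Op.
  have s14 : 4^-1 <= sqnorm (grad tilt p).
    by rewrite /sqnorm tilt_grad; have := sqr_ge0 (grad tilt p).2; lra.
  have s0 : 0 < sqnorm (grad tilt p) by apply: lt_le_trans s14; rewrite invr_gt0.
  rewrite integrandE// lee_fin indicE.
  have -> : p \in csquare 0 1.
    rewrite inE; apply/csquareP; rewrite !subr0; exact: Omega_coord.
  by rewrite mulr1 -[leRHS]invrK lef_pV2// posrE invr_gt0.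
under eq_integral do rewrite EFinM.
rewrite ge0_integralZl_EFin//; last first.
  by apply/measurable_EFinP; apply: measurable_indic; exact: measurable_csquare.
rewrite integral_indic//; last exact: measurable_csquare.
by rewrite setIT [X in (_ * X)%E](measure_csquare 0 _ ltr01) -EFinM ltry.
Qed.

End Functional.

Arguments csquare {R}.
Arguments integrand {R}.

(** * Gradients of perturbations and bounds for the bump *)

Section LocalPerturbation.
Context (R : realType).
Implicit Types (p q z e a : R * R) (u phi : R * R -> R).

Lemma grad_perturb u phi g (C tau : R) p :
  (forall i, derivable u p (stdvec R i)) -> C11 phi g C ->
  nbhs p (@Omega R) ->
  grad (fun q => u q + tau * phi q) p = grad u p + tau *: g p.
Proof.
move=> du phiC Op.
have D i : 'D_(stdvec R i) (fun q => u q + tau * phi q) p =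
    'D_(stdvec R i) u p + tau * dot (g p) (stdvec R i).
  have d1 := derivableP (du i).
  have d2 := is_deriveZ tau (C11_is_derive _ _ _ _ _ (stdvec R i) phiC Op).
  by have [_] := is_deriveD d1 d2.
apply: pair_eq; rewrite !pairE /grad [LHS]/= D /=; congr (_ + tau * _).
  by rewrite /dot /= mulr1 mulr0 addr0.
by rewrite /dot /= mulr1 mulr0 add0r.
Qed.

(** The total derivative operator depends only on the germ of the function, so the
equality holds also where u is not differentiable. *)
Lemma grad_perturb_out u phi (tau : R) p :
  (\forall q \near p, phi q = 0) ->
  grad (fun q => u q + tau * phi q) p = grad u p.
Proof.
move=> phi0.
have E i : 'D_(stdvec R i) (fun q => u q + tau * phi q) p =
    'D_(stdvec R i) u p.
  apply: near_eq_derive => //.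
  by apply: filterS phi0 => q ->; rewrite mulr0 addr0.
by rewrite /grad !E.
Qed.

Lemma near_notin_csquare z (b : R) p : ~ csquare z b p ->
  \forall q \near p, ~ csquare z b q.
Proof.
move=> np; apply/nbhs_osquareP.
have [h|h] := lerP `|p.1 - z.1| b; last first.
  exists (`|p.1 - z.1| - b); first by rewrite subr_gt0.
  move=> q q1 _ /csquareP[q2 _].
  have := ler_normD (p.1 - q.1) (q.1 - z.1).
  by rewrite addrA subrK (distrC p.1 q.1); lra.
have [h'|h'] := lerP `|p.2 - z.2| b; first by case: np; apply/csquareP.
exists (`|p.2 - z.2| - b); first by rewrite subr_gt0.
move=> q _ q1 /csquareP[_ q2].
have := ler_normD (p.2 - q.2) (q.2 - z.2).
by rewrite addrA subrK (distrC p.2 q.2); lra.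
Qed.

Lemma bump1_eq0 (b c x : R) : 0 < b -> b < `|x - c| -> bump1 b c x = 0.
Proof.
move=> b0 bx; rewrite /bump1.
have : b ^+ 2 - (x - c) ^+ 2 < 0.
  by rewrite -(real_normK (num_real (x - c))); nra.
by have [[h ->]|[h ->]] := pospart_cases R (b ^+ 2 - (x - c) ^+ 2); rewrite ?expr0n//; lra.
Qed.

Lemma bump2_eq0 z (b : R) p : 0 < b -> ~ csquare z b p -> bump2 b z p = 0.
Proof.
move=> b0 np; rewrite /bump2.
have [h|h] := lerP `|p.1 - z.1| b; last by rewrite bump1_eq0// mul0r.
have [h'|h'] := lerP `|p.2 - z.2| b; last by rewrite [X in _ * X]bump1_eq0// mulr0.
by case: np; apply/csquareP.
Qed.

Lemma bump1_ge (b c x : R) : 0 < b -> `|x - c| <= b / 2 ->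
  9 / 16 * b ^+ 4 <= bump1 b c x.
Proof.
move=> b0 bx; rewrite /bump1.
have h1 : 3 / 4 * b ^+ 2 <= b ^+ 2 - (x - c) ^+ 2.
  by rewrite -(real_normK (num_real (x - c))); have := normr_ge0 (x - c); nra.
have b20 : 0 < b ^+ 2 by rewrite exprn_gt0.
have h2 : 3 / 4 * b ^+ 2 <= pospart (b ^+ 2 - (x - c) ^+ 2).
  by have [[h ->]|[h ->]] := pospart_cases R (b ^+ 2 - (x - c) ^+ 2) => //; lra.
have -> : 9 / 16 * b ^+ 4 = (3 / 4 * b ^+ 2) ^+ 2 by field.
have b34 : 0 <= 3 / 4 * b ^+ 2 by rewrite mulr_ge0 ?ltW// divr_gt0.
by rewrite ler_pXn2r// nnegrE// (le_trans b34).
Qed.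

Lemma bump2_sqr_ge z (b : R) p : 0 < b -> csquare z (b / 2) p ->
  (9 / 16 * b ^+ 4) ^+ 4 <= bump2 b z p ^+ 2.
Proof.
move=> b0 /csquareP[h1 h2].
have m0 : 0 <= 9 / 16 * b ^+ 4 by rewrite mulr_ge0 ?divr_ge0// exprn_ge0// ltW.
have g1 := bump1_ge _ _ _ b0 h1; have g2 := bump1_ge _ _ _ b0 h2.
have -> : (9 / 16 * b ^+ 4) ^+ 4 = ((9 / 16 * b ^+ 4) * (9 / 16 * b ^+ 4)) ^+ 2.
  by rewrite [in RHS]exprMn -!exprD.
have mm : 0 <= (9 / 16 * b ^+ 4) * (9 / 16 * b ^+ 4) by exact: mulr_ge0.
have gg : (9 / 16 * b ^+ 4) * (9 / 16 * b ^+ 4) <= bump2 b z p by exact: ler_pM.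
by rewrite ler_pXn2r// nnegrE// (le_trans mm).
Qed.

Lemma small_mul_le (t X Y : R) : 0 <= X -> 0 < Y -> 0 <= t ->
  t <= Y / (1 + X) -> t * X <= Y.
Proof.
move=> X0 Y0 t0; rewrite ler_pdivlMr; last by lra.
by lra.
Qed.

Lemma exists_small (c d C M P0 : R) : 0 < c -> 0 < d -> 0 <= C -> 0 <= M ->
  0 < P0 -> exists t, [/\ 0 < t, t * C <= c, t * C <= d,
    8 * (t ^+ 2 * M) <= P0 / 2 & 50 * (t ^+ 2 * M ^+ 2) <= P0 ^+ 3 / 8].
Proof.
move=> c0 d0 C0 M0 P00.
have P30 : 0 < P0 ^+ 3 by rewrite exprn_gt0.
have M20 : 0 <= M ^+ 2 by rewrite sqr_ge0.
pose t := Num.min 1 (Num.min (c / (1 + C)) (Num.min (d / (1 + C))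
  (Num.min (P0 / 2 / (1 + 8 * M)) (P0 ^+ 3 / 8 / (1 + 50 * M ^+ 2))))).
have t0 : 0 < t by rewrite !lt_min ltr01 !divr_gt0//; lra.
have : t <= t by [].
rewrite {2}/t !le_min => /and5P[t1 tc td tP tM].
have tt : t ^+ 2 <= t by rewrite expr2 ler_piMl// ltW.
exists t; split => //.
- by apply: small_mul_le => //; exact: ltW.
- by apply: small_mul_le => //; exact: ltW.
- apply: (@le_trans _ _ (t * (8 * M))); last first.
    by apply: small_mul_le => //; [lra|lra|exact: ltW].
  by rewrite mulrCA ler_wpM2r//; lra.
- apply: (@le_trans _ _ (t * (50 * M ^+ 2))); last first.
    by apply: small_mul_le => //; [lra|lra|exact: ltW].
  by rewrite mulrCA ler_wpM2r//; lra.
Qed.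

End LocalPerturbation.

(** * The oscillating perturbations *)

Section Competitors.
Context (R : realType).
Implicit Types (p q z e a : R * R) (u phi : R * R -> R).
#[local] Opaque grad.

Lemma dotvN p q : dot p (- q) = - dot p q.
Proof. by rewrite /dot !pairE !mulrN opprD. Qed.

(** At the values 0 and -1 the point z is a maximum or a minimum of u, and the
gradient vanishes. *)
Lemma strictly_between omega u z : open omega -> omega `<=` @Omega R ->
  C1_on omega u -> Chat u -> omega z -> grad u z != 0 -> -1 < u z < 0.
Proof.
move=> wo wO uC1 [urange _ _] wz gz.
have wn : nbhs z omega by exact: open_nbhs_nbhs.
have gpos := sqnorm_gt0 R _ gz.
have dotgg : dot (grad u z) (grad u z) = sqnorm (grad u z).
  by rewrite /dot /sqnorm !expr2.
have /andP[u1 u2] := urange _ (wO _ wz).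
have [d d0 dP] := nbhs_line R _ (grad u z) _ wn.
have [d' d'0 dP'] := nbhs_line R _ (- grad u z) _ wn.
rewrite !lt_neqAle u1 u2 !andbT; apply/andP; split; apply/eqP => uz.
  have := grad_ge R omega wo u uC1 z (- grad u z) 0 d' wz d'0.
  have -> : dot (grad u z) (- grad u z) = - sqnorm (grad u z).
    by rewrite dotvN dotgg.
  suff H : forall s : R, 0 < s -> s < d' -> u z + s * 0 <= u (z + s *: - grad u z).
    by move=> /(_ H); rewrite oppr_ge0 leNgt gpos.
  move=> s s0 sd; rewrite mulr0 addr0 -uz.
  have /dP'/wO/urange/andP[] // : `|s| < d' by rewrite gtr0_norm.
have := grad_le R omega wo u uC1 z (grad u z) 0 d wz d0.
suff H : forall s : R, 0 < s -> s < d -> u (z + s *: grad u z) <= u z + s * 0.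
  by move=> /(_ H); rewrite dotgg leNgt gpos.
move=> s s0 sd; rewrite mulr0 addr0 uz.
have /dP/wO/urange/andP[] // : `|s| < d by rewrite gtr0_norm.
Qed.

Definition wave (trig : R -> R) (b : R) z a p := bump2 b z p * trig (dot a p).
(** The gradient of [wave], for [dtrig] the derivative of [trig]. *)
Definition dwave (trig dtrig : R -> R) (b : R) z a p :=
  bump2 b z p *: (dtrig (dot a p) *: a) + trig (dot a p) *: dbump2 b z p.

Lemma sqnorm_le (C : R) v : `|v.1| <= C -> `|v.2| <= C -> sqnorm v <= 2 * C ^+ 2.
Proof.
move=> v1 v2; have C0 : 0 <= C by exact: le_trans v1.
rewrite /sqnorm -(real_normK (num_real v.1)) -(real_normK (num_real v.2)).
have : `|v.1| ^+ 2 <= C ^+ 2 by rewrite ler_pXn2r// nnegrE.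
have : `|v.2| ^+ 2 <= C ^+ 2 by rewrite ler_pXn2r// nnegrE.
lra.
Qed.

Lemma waves_C11 (b : R) z a : 0 < b -> b <= 1 -> Omega z -> exists C,
  C11 (wave sin b z a) (dwave sin cos b z a) C /\
  C11 (wave cos b z a) (dwave cos (- sin) b z a) C.
Proof.
move=> b0 b1 Oz; have [C hC] := bump2_C11 R b z b0 b1 Oz.
have C0 : 0 <= C by have [h _ _ _] := hC _ _ Oz Oz; exact: le_trans h.
exists (20 * (C * (1 + sqnorm a))); split.
  exact: C11M hC (C11_sin R a).
exact: C11M hC (C11_cos R a).
Qed.

Lemma four_sum (f : \bar R) : (0 <= f)%E -> (f + f + f + f <= 4%:R%:E * f)%E.
Proof.
case: f => [r| |] //; last by rewrite mulry gtr0_sg// mul1e leey.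
by move=> _; rewrite -!EFinD -EFinM lee_fin; lra.
Qed.

End Competitors.

Arguments wave {R}.
Arguments dwave {R}.

(** * Descent *)

Section Descent.
Context (R : realType).
Implicit Types (p q z e a : R * R) (u phi : R * R -> R).
Local Notation mu2 := (@lebesgue_measure R \x @lebesgue_measure R)%E.
#[local] Opaque grad.

Definition competitor u (b : R) z a (t : R) (i : 'I_4) : R * R -> R :=
  nth u [:: fun q => u q + t * wave sin b z a q;
            fun q => u q + (- t) * wave sin b z a q;
            fun q => u q + t * wave cos b z a q;
            fun q => u q + (- t) * wave cos b z a q] i.

(** Off the support of the bump the competitors have the germ of u. The integrand may
be infinite there. *)
Lemma sum_competitor_out u (b : R) z a (t : R) p : 0 < b -> ~ csquare z b p ->
  (\sum_(i < 4) integrand (competitor u b z a t i) p <= 4%:R%:E * integrand u p)%E.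
Proof.
move=> b0 np; have w0 trig : \forall q \near p, wave trig b z a q = 0.
  apply: filterS (near_notin_csquare _ _ _ _ np) => q nq.
  by rewrite /wave bump2_eq0// mul0r.
apply: le_trans (four_sum _ _ (integrand_ge0 _ u p)).
rewrite !big_ord_recr big_ord0 /= add0e /competitor /= /integrand.
by rewrite !grad_perturb_out.
Qed.

Lemma sum_competitor_in u (b : R) z e (N t C P0 Gb M : R) p (a := N *: e) :
  C11 (wave sin b z a) (dwave sin cos b z a) C ->
  C11 (wave cos b z a) (dwave cos (- sin) b z a) C ->
  nbhs p (@Omega R) -> (forall i, derivable u p (stdvec R i)) ->
  0 < P0 -> sqnorm e = P0 ->
  P0 / 2 <= sqnorm (grad u p) -> sqnorm (grad u p) <= 2 * P0 ->
  qform (grad u p) e <= - P0 ^+ 2 / 2 ->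
  sqnorm (dbump2 b z p) <= Gb -> 2 * C ^+ 2 <= M ->
  8 * (t ^+ 2 * M) <= P0 / 2 -> 50 * (t ^+ 2 * M ^+ 2) <= P0 ^+ 3 / 8 ->
  (\sum_(i < 4) integrand (competitor u b z a t i) p
    + (t ^+ 2 * (N ^+ 2 * bump2 b z p ^+ 2 / (8 * P0)))%:E
   <= 4%:R%:E * integrand u p + (t ^+ 2 * (24 * Gb / P0 ^+ 2 + 1))%:E)%E.
Proof.
move=> C1 C2 nO du P00 eP PG GP qe dG CM t1 t2.
have Op := nbhs_singleton nO.
have h1M : sqnorm (dwave sin cos b z a p) <= M.
  by apply: le_trans CM; have [_ ? ? _] := C1 _ _ Op Op; exact: sqnorm_le.
have h2M : sqnorm (dwave cos (- sin) b z a p) <= M.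
  by apply: le_trans CM; have [_ ? ? _] := C2 _ _ Op Op; exact: sqnorm_le.
have sc : sin (dot a p) ^+ 2 + cos (dot a p) ^+ 2 = 1 by rewrite addrC cos2Dsin2.
have [p1 p2 p3 p4 main] := four_directions_le R (grad u p) e (dbump2 b z p)
  N (bump2 b z p) _ _ t P0 Gb M P00 eP PG GP qe sc dG h1M h2M t1 t2.
have gE trig dtrig s : C11 (wave trig b z a) (dwave trig dtrig b z a) C ->
    grad (fun q => u q + s * wave trig b z a q) p =
    grad u p + s *: dwave trig dtrig b z a p.
  by move=> CC; exact: grad_perturb CC nO.
rewrite !big_ord_recr big_ord0 /= add0e /competitor /=.
rewrite !integrandE ?(gE _ _ _ C1) ?(gE _ _ _ C2) //; last first.
  by apply: lt_le_trans PG; rewrite divr_gt0.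
by rewrite -!(EFinD, EFinM) lee_fin; move: main; rewrite !addrA.
Qed.

Lemma half_way_range (x y : R) : `|x - y| < Num.min (1 + y) (- y) / 2 ->
  -1 + Num.min (1 + y) (- y) / 2 <= x <= - (Num.min (1 + y) (- y) / 2).
Proof.
have e1 : Num.min (1 + y) (- y) <= 1 + y by rewrite ge_min lexx.
have e2 : Num.min (1 + y) (- y) <= - y by rewrite ge_min lexx orbT.
move: e1 e2; move: (Num.min _ _) => d e1 e2.
by rewrite ltr_norml => /andP[h1 h2]; apply/andP; split; lra.
Qed.

Lemma half_le (x : R) : 0 < x -> x / 2 <= x.
Proof. lra. Qed.

Lemma scaled_min_le (x : R) : 128 * Num.min 1 (x / 128) <= x.
Proof. by rewrite mulrC -ler_pdivlMr// ge_min lexx orbT. Qed.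

(** The left side is the gain of the frequency [N] on the inner square, of area b^2;
the right side bounds the loss on the support of the bump, of area 4 b^2. *)
Lemma amplitude_contra (t b m P0 L : R) (N := 1 + 32 * L * P0 / m) :
  0 < t -> 0 < b -> 0 < m -> 0 < P0 -> 0 < L ->
  t ^+ 2 * (N ^+ 2 * m / (8 * P0)) * (4 * (b / 2) ^+ 2)
    <= t ^+ 2 * L * (4 * b ^+ 2) -> False.
Proof.
move=> t0 b0 m0 P00 L0; apply/negP; rewrite -ltNge.
have -> : t ^+ 2 * (N ^+ 2 * m / (8 * P0)) * (4 * (b / 2) ^+ 2) =
  t ^+ 2 * b ^+ 2 * (N ^+ 2 * m / (8 * P0)) by field; rewrite gt_eqF.
have -> : t ^+ 2 * L * (4 * b ^+ 2) = t ^+ 2 * b ^+ 2 * (4 * L) by ring.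
have tb : 0 < t ^+ 2 * b ^+ 2 by rewrite mulr_gt0 ?exprn_gt0.
rewrite ltr_pM2l// ltr_pdivlMr ?mulr_gt0//.
have -> : 4 * L * (8 * P0) = 32 * L * P0 by ring.
have LP : 0 < 32 * L * P0 by rewrite !mulr_gt0.
have X0 : 0 < 32 * L * P0 / m by exact: divr_gt0.
rewrite -ltr_pdivrMr//.
have NN : N <= N ^+ 2 by rewrite expr2 ler_peMl// /N; lra.
by apply: lt_le_trans NN; rewrite /N ltrDr.
Qed.

Lemma competitor_cases u (b : R) z a t (P : (R * R -> R) -> Prop) :
  (forall tau, `|tau| = `|t| -> P (fun q => u q + tau * wave sin b z a q)) ->
  (forall tau, `|tau| = `|t| -> P (fun q => u q + tau * wave cos b z a q)) ->
  forall i, P (competitor u b z a t i).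
Proof.
by move=> Ps Pc [[|[|[|[|i]]]] hi] //; rewrite /competitor /=;
  (apply: Ps || apply: Pc); rewrite ?normrN.
Qed.

End Descent.

Arguments competitor {R}.

Theorem mainTheorem5 (R : realType) (u : R * R -> R)
    (hu : minimizer (@Chat R) (@Jinfty R) u)
    (omega : set (R * R)) (omega_open : open omega)
    (omega_neq0 : omega !=set0) (omega_sub : omega `<=` @Omega R)
    (u_C2 : Cn_on 2 omega u) :
  ~ strictly_convex_on omega u.
Proof.
move=> uS; have [uChat umin] := hu.
have [urange uConv ulsc] := uChat.
have [uC uC1 uC2] := Cn_on2_C1 R omega u u_C2.
have [z [r [c [r0 c0 sw gz strong]]]] :=
  exists_strongly_convex_square R omega omega_open u uC uC1 uC2 uS omega_neq0.
have wz : omega z by apply: sw; split; rewrite subrr normr0.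
have Oz := omega_sub _ wz.
have [c' c'0 ugap] := exists_conv_gap_ge R u uConv z r c r0 c0
  (subset_trans sw omega_sub) strong.
have /andP[uz1 uz0] := strictly_between R omega u z omega_open omega_sub uC1
  uChat wz gz.
set P0 := sqnorm (grad u z).
have P00 : 0 < P0 by exact: sqnorm_gt0.
(* The margin that is left to u + tau phi in [-1, 0]. *)
pose del := Num.min (1 + u z) (- u z) / 2.
have del0 : 0 < del by rewrite divr_gt0// lt_min; apply/andP; split; lra.
(* The variation of grad u that [qform_rot_le] tolerates. *)
pose k := Num.min 1 (P0 / 128).
have k0 : 0 < k by rewrite lt_min ltr01 divr_gt0.
have n1 := continuous_near R _ _ _ (uC _ wz) del0.
have n2 := grad_near R _ omega_open _ _ _ uC1 wz k0.
have [d d0 dP] := (nbhs_osquareP R z _).1 (filterI n1 n2).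
pose rho := Num.min d (r / 2).
have rho0 : 0 < rho by rewrite lt_min d0 divr_gt0.
pose b := Num.min 1 rho / 2.
have b0 : 0 < b by rewrite divr_gt0// lt_min ltr01.
have b1 : b <= 1.
  have : Num.min 1 rho <= 1 by rewrite ge_min lexx.
  by rewrite /b; move: (Num.min _ _) => x; lra.
have brho : b < rho.
  have : Num.min 1 rho <= rho by rewrite ge_min lexx orbT.
  by rewrite /b; move: rho0 (Num.min _ _); clear; move: rho => y y0 x; lra.
pose K := osquare z rho.
have KP q : K q -> [/\ -1 + del <= u q <= - del, omega q,
    `|(grad u q).1 - (grad u z).1| < k & `|(grad u q).2 - (grad u z).2| < k].
  move=> [/= q1 q2]; have [||uq [wq [g1 g2]]] := dP q.
  - by apply: lt_le_trans q1 _; rewrite ge_min lexx.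
  - by apply: lt_le_trans q2 _; rewrite ge_min lexx.
  by split; [exact: half_way_range|exact: wq|exact: g1|exact: g2].
have BK q : csquare z b q -> K q.
  by move=> /csquareP[q1 q2]; split; exact: le_lt_trans brho.
have KO : K `<=` @Omega R by move=> q /KP[_ /omega_sub].
have Kgap x y (t : R) : Omega x -> Omega y -> 0 <= t <= 1 ->
    (K x \/ K y \/ K (t *: x + (1 - t) *: y)%R) ->
    c' * (t * (1 - t)) * sqnorm (x - y) <= conv_gap u t x y.
  have KK q : K q -> osquare z (r / 2) q.
    by move=> [q1 q2]; split; [apply: lt_le_trans q1 _|apply: lt_le_trans q2 _];
      rewrite ge_min lexx orbT.
  move=> Ox Oy t01 h; apply: ugap => //.
  by case: h => [/KK|[/KK|/KK]] h; [left|right; left|right; right].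
have [Ceta hCeta] := bump2_C11 R b z b0 b1 Oz.
pose Gb := 2 * Ceta ^+ 2.
pose L := 24 * Gb / P0 ^+ 2 + 1.
have L0 : 0 < L.
  have Gb0 : 0 <= Gb by apply: mulr_ge0 => //; exact: sqr_ge0.
  by apply: ltr_wpDl => //; apply: divr_ge0 (sqr_ge0 _); exact: mulr_ge0.
pose m := (9 / 16 * b ^+ 4) ^+ 4.
have m0 : 0 < m by rewrite exprn_gt0// mulr_gt0 ?divr_gt0// exprn_gt0.
(* L depends on the bump only, so the frequency can be chosen after it. *)
pose N := 1 + 32 * L * P0 / m.
pose e : R * R := (- (grad u z).2, (grad u z).1).
have eP : sqnorm e = P0 by rewrite /P0 /sqnorm /= sqrrN addrC.
pose a := N *: e.
have [C [C1 C2]] := waves_C11 R b z a b0 b1 Oz.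
have C0 : 0 <= C by have [h _ _ _] := C1 _ _ Oz Oz; exact: le_trans h.
pose M := 2 * C ^+ 2.
have M0 : 0 <= M by exact: mulr_ge0 (ler0n R 2) (sqr_ge0 _).
have [t [t0 tc td t1 t2]] := exists_small R c' del C M P0 c'0 del0 C0 M0 P00.
have compC i : Chat (competitor u b z a t i).
  have wave0 trig q : ~ K q -> wave trig b z a q = 0.
    move=> nK; have nB : ~ csquare z b q by move=> /BK.
    by rewrite /wave (bump2_eq0 _ _ _ _ b0 nB) mul0r.
  have uK q : K q -> -1 + del <= u q <= - del by move=> /KP[].
  move: i; apply: competitor_cases => tau tauE.
    by apply: (perturb_Chat R u (wave sin b z a) _ C tau c' del K uChat C1 KO
      (wave0 _) uK Kgap); rewrite tauE gtr0_norm.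
  by apply: (perturb_Chat R u (wave cos b z a) _ C tau c' del K uChat C2 KO
    (wave0 _) uK Kgap); rewrite tauE gtr0_norm.
have b20 : 0 < b / 2 by rewrite divr_gt0.
have AB q : csquare z (b / 2) q -> csquare z b q.
  have h := half_le R b b0.
  by move=> /csquareP[q1 q2]; apply/csquareP; split; exact: le_trans h.
have := @measure_le_of_minimal _ _ R (@lebesgue_measure R \x @lebesgue_measure R)%E
  4 (integrand u \_ (@Omega R))
  (fun i => integrand (competitor u b z a t i) \_ (@Omega R))
  (csquare z (b / 2)) (csquare z b)
  (t ^+ 2 * (N ^+ 2 * m / (8 * P0))) (t ^+ 2 * L) _ _ isT
  (measurable_csquare _ _ _) (measurable_csquare _ _ _)
  (measure_csquare _ _ _ b20) (measure_csquare _ _ _ b0).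
have P80 : 0 < 8 * P0 by exact: mulr_gt0.
have a0 : 0 <= t ^+ 2 * (N ^+ 2 * m / (8 * P0)).
  apply: mulr_ge0 (sqr_ge0 _) (divr_ge0 (mulr_ge0 (sqr_ge0 _) (ltW m0)) (ltW P80)).
have bb0 : 0 <= t ^+ 2 * L by exact: mulr_ge0 (sqr_ge0 _) (ltW L0).
move=> /(_ a0 bb0 (restrict_ge0 _ u) (fun i => restrict_ge0 _ _)).
have pw x : (\sum_(i < 4) (integrand (competitor u b z a t i) \_ (@Omega R)) x
    + (t ^+ 2 * (N ^+ 2 * m / (8 * P0)) * \1_(csquare z (b / 2)) x)%:E
    <= 4%:R%:E * (integrand u \_ (@Omega R)) x
       + (t ^+ 2 * L * \1_(csquare z b) x)%:E)%E.
  have [xB|xB] := pselect (csquare z b x); last first.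
    have xA : ~ csquare z (b / 2) x by move=> /AB.
    rewrite !indicE (memNset xB) (memNset xA).
    rewrite !mulr0 !adde0 /patch; case: ifP => xO; last first.
      by rewrite big1// mule0.
    exact: sum_competitor_out.
  have Kx := BK _ xB; have [_ wx g1 g2] := KP _ Kx.
  rewrite /patch (mem_set (KO _ Kx)) !indicE (mem_set xB) mulr1.
  have xO : nbhs x (@Omega R).
    by apply: filterS omega_sub _; exact: open_nbhs_nbhs.
  have k1 : k <= 1 by rewrite ge_min lexx.
  have k2 : 128 * k <= P0 by exact: scaled_min_le.
  have [q1 q2 q3] := qform_rot_le R (grad u x) (grad u z) k P00 k1 k2 g1 g2.
  have dG : sqnorm (dbump2 b z x) <= Gb.
    by have [_ ? ? _] := hCeta _ _ (KO _ Kx) (KO _ Kx); exact: sqnorm_le.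
  have main := sum_competitor_in R u b z e N t C P0 Gb M x C1 C2 xO
    (fun i => (uC1 i x wx).1) P00 eP q1 q2 q3 dG (lexx _) t1 t2.
  apply: le_trans main; apply: leeD2l; rewrite lee_fin.
  have [xA|xA] := pselect (csquare z (b / 2) x); last first.
    rewrite memNset; last exact: xA.
    rewrite mulr0; apply: mulr_ge0 (sqr_ge0 _) _.
    exact: divr_ge0 (mulr_ge0 (sqr_ge0 _) (sqr_ge0 _)) (ltW P80).
  rewrite (mem_set xA) mulr1; apply: ler_wpM2l (sqr_ge0 _) _ _ _.
  rewrite ler_pM2r; last by rewrite invr_gt0.
  by apply: ler_wpM2l (sqr_ge0 _) _ _ _; exact: bump2_sqr_ge.
move=> /(_ pw).
have Jle i : (\int[(@lebesgue_measure R \x @lebesgue_measure R)%E]_x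
     (integrand u \_ (@Omega R)) x
   <= \int[(@lebesgue_measure R \x @lebesgue_measure R)%E]_x
     (integrand (competitor u b z a t i) \_ (@Omega R)) x)%E.
  by have := umin _ (compC i); rewrite !JinftyE.
move=> /(_ Jle).
have Joo : (\int[(@lebesgue_measure R \x @lebesgue_measure R)%E]_x
     (integrand u \_ (@Omega R)) x < +oo)%E.
  rewrite -JinftyE; apply: le_lt_trans (Jinfty_tilt_lty R).
  exact: umin _ (tilt_Chat R).
move=> /(_ Joo); exact: amplitude_contra.
Qed.
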